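(* Let $\mathcal{A}$ be a finite list in a finitely generated abelian group $\Gamma$ and $G$ a torsion-wise finite abelian group. Then: (1) if $\mathcal{S}\subset\mathcal{A}$ and $\alpha\in\mathcal{A}$ satisfy $r_{\mathcal{S}\cup\{\alpha\}}=r_{\mathcal{S}}$, then $m(\mathcal{S}\cup\{\alpha\};G)$ divides $m(\mathcal{S};G)$; (2) if $r_{\mathcal{S}\cup\{\alpha\}}=r_{\mathcal{S}}+1$, then $m(\mathcal{S};G)$ divides $m(\mathcal{S}\cup\{\alpha\};G)$; (4) if $\mathcal{S}\subset\mathcal{T}\subset\mathcal{A}$ and $r_{\mathcal{S}}=r_{\mathcal{T}}$, then $\sum_{\mathcal{S}\subset\mathcal{B}\subset\mathcal{T}}(-1)^{\#\mathcal{B}-\#\mathcal{S}}m(\mathcal{B};G)\ge0$; (5) if $\mathcal{S}\subset\mathcal{T}\subset\mathcal{A}$ and $r_{\mathcal{T}}=r_{\mathcal{S}}+\#(\mathcal{T}\smallsetminus\mathcal{S})$, then $\sum_{\mathcal{S}\subset\mathcal{B}\subset\mathcal{T}}(-1)^{\#\mathcal{T}-\#\mathcal{B}}m(\mathcal{B};G)\ge0$. If moreover $G$ is divisible (multiplication by $k$ is surjective on $G$ for every positive integer $k$), then also: (3) if $\mathcal{S}\subset\mathcal{T}\subset\mathcal{A}$ and $\mathcal{T}=\mathcal{S}\sqcup\mathcal{B}\sqcup\mathcal{C}$ is such that $r_{\mathcal{R}}=r_{\mathcal{S}}+\#(\mathcal{R}\cap\mathcal{B})$ for all $\mathcal{S}\subset\mathcal{R}\subset\mathcal{T}$,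 then $m(\mathcal{S};G)\,m(\mathcal{T};G)=m(\mathcal{S}\sqcup\mathcal{B};G)\,m(\mathcal{S}\sqcup\mathcal{C};G)$.
   Context: $G$ is torsion-wise finite if $G[d]=\{x\in G\mid dx=0\}$ is finite for all $d>0$. Sublists are distinguished by index (sums run over sublists $\mathcal{B}$ with $\mathcal{S}\subset\mathcal{B}\subset\mathcal{T}$). $r_{\mathcal{S}}$ is the rank of $\langle\mathcal{S}\rangle$ and $m(\mathcal{S};G)=\#\mathrm{Hom}((\Gamma/\langle\mathcal{S}\rangle)_{\mathrm{tor}},G)$. *)

(* Defs.v *)
From HB Require Import structures.
From mathcomp Require Import all_boot all_order all_algebra.
From Stdlib Require Import ClassicalEpsilon.
Set Implicit Arguments. Unset Strict Implicit. Unset Printing Implicit Defensive.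
Import Order.TTheory GRing.Theory Num.Theory.
Local Open Scope ring_scope.

Definition pick_nat (P : nat -> Prop) : nat :=
  match excluded_middle_informative (exists k, P k) with
  | left e => proj1_sig (constructive_indefinite_description _ e)
  | right _ => 0%N
  end.

Definition fin_gen (Gam : zmodType) : Prop :=
  exists (k : nat) (g : 'I_k -> Gam),
    forall x : Gam, exists c : 'I_k -> int, x = \sum_(i < k) g i *~ c i.

Definition torsionwise_finite (G : zmodType) : Prop :=
  forall d : nat, (0 < d)%N ->
    exists s : seq G, forall x : G, x *+ d = 0 -> x \in s.

Definition divisible (G : zmodType) : Prop :=
  forall k : nat, (0 < k)%N -> forall y : G, exists x : G, x *+ k = y.

Definition zindep (Gam : zmodType) (k : nat) (v : 'I_k -> Gam) : Prop :=
  forall c : 'I_k -> int, \sum_(i < k) v i *~ c i = 0 -> forall i, c i = 0.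

Definition is_rank (Gam : zmodType) (H : Gam -> Prop) (r : nat) : Prop :=
  (exists v : 'I_r -> Gam, (forall i, H (v i)) /\ zindep v) /\
  (forall (k : nat) (v : 'I_k -> Gam), (forall i, H (v i)) -> zindep v -> (k <= r)%N).

Definition zrank (Gam : zmodType) (H : Gam -> Prop) : nat := pick_nat (is_rank H).

(* Sublists of the list A = (A 0, ..., A (n-1)) are index sets S : {set 'I_n}. *)
Definition gen (Gam : zmodType) (n : nat) (A : 'I_n -> Gam) (S : {set 'I_n}) (x : Gam) : Prop :=
  exists c : 'I_n -> int, x = \sum_(i in S) A i *~ c i.

Definition rk (Gam : zmodType) (n : nat) (A : 'I_n -> Gam) (S : {set 'I_n}) : nat :=
  zrank (gen A S).

(* Preimage in Gamma of (Gamma/<S>)_tor. *)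
Definition tor (Gam : zmodType) (n : nat) (A : 'I_n -> Gam) (S : {set 'I_n}) (x : Gam) : Prop :=
  exists k : nat, (0 < k)%N /\ gen A S (x *+ k).

(* Homomorphisms (Gamma/<S>)_tor -> G, represented (universal property of the
   quotient) as maps defined on the preimage tor S, additive there and
   vanishing on <S>; two such maps are identified when they agree on tor S. *)
Definition is_hom (Gam G : zmodType) (n : nat) (A : 'I_n -> Gam) (S : {set 'I_n})
  (f : Gam -> G) : Prop :=
  (forall x y, tor A S x -> tor A S y -> f (x + y) = f x + f y) /\
  (forall x, gen A S x -> f x = 0).

Definition hom_eq (Gam G : zmodType) (n : nat) (A : 'I_n -> Gam) (S : {set 'I_n})
  (f g : Gam -> G) : Prop := forall x, tor A S x -> f x = g x.

Definition has_card (X : Type) (P : X -> Prop) (E : X -> X -> Prop) (k : nat) : Prop :=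
  exists f : 'I_k -> X,
    (forall i, P (f i)) /\ (forall i j, E (f i) (f j) -> i = j) /\
    (forall x, P x -> exists i, E x (f i)).

Definition mult (Gam G : zmodType) (n : nat) (A : 'I_n -> Gam) (S : {set 'I_n}) : nat :=
  pick_nat (has_card (@is_hom Gam G n A S) (@hom_eq Gam G n A S)).

(* Main.v *)
Require Import Defs.
From HB Require Import structures.
From mathcomp Require Import all_boot all_order all_algebra.
From Stdlib Require Import ClassicalEpsilon.
Import Order.TTheory GRing.Theory Num.Theory.
Local Open Scope ring_scope.
Set Implicit Arguments. Unset Strict Implicit. Unset Printing Implicit Defensive.

(* If [U] lies in the torsion closure of [<S>], the homomorphisms for [S u U] are the
   homomorphisms for [S] that vanish on [U]. Hence (1) is a count of fibres of an
   evaluation map, and the sum in (4) counts, by inclusion-exclusion, the homomorphisms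
   for [S] vanishing at no element of [T \ S].
   For (2) and (5), present Gamma as the quotient of Z^k by the row lattice of [R], and
   stack [R] and lifts of the list into an integer matrix [M]. By the Smith normal form
   the cokernels of a matrix and of its transpose have isomorphic torsion, so the
   multiplicity of [B] is the one of the complement of [B] in the Gale dual list, the
   unit vectors modulo the column lattice of [M]; there (2) and (5) become (1) and (4).
   For (3), the homomorphisms for [S] and for [S u B] take the same tuples of values on
   [C]: restrict one way, extend the other way by divisibility of G. So passing from [S]
   to [S u C] and from [S u B] to [S u B u C] divides the count by the same number. *)

(** * Counting up to an equivalence *)

Lemma fun_choice (X Y : Type) (Q : X -> Y -> Prop) :
  (forall x, exists y, Q x y) -> exists f, forall x, Q x (f x).
Proof.
move=> h; exists (fun x => proj1_sig (constructive_indefinite_description _ (h x))).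
by move=> x; case: (constructive_indefinite_description _ _).
Qed.

Lemma pick_natP (P : nat -> Prop) : (exists k, P k) -> P (pick_nat P).
Proof.
move=> h; rewrite /pick_nat; case: (excluded_middle_informative _) => // e.
by case: (constructive_indefinite_description _ _).
Qed.

(** A relation that is total in both directions and compatible with the two equivalences induces a
    bijection of classes, so no canonical map has to be exhibited. *)
Lemma has_card_corr (X Y : Type) (P : X -> Prop) (E : X -> X -> Prop)
    (P' : Y -> Prop) (E' : Y -> Y -> Prop) (Q : X -> Y -> Prop) (k : nat) :
  (forall x, P x -> exists y, P' y /\ Q x y) ->
  (forall y, P' y -> exists x, P x /\ Q x y) ->
  (forall x x' y y', P x -> P x' -> P' y -> P' y' -> Q x y -> Q x' y' ->
     E x x' <-> E' y y') ->
  has_card P E k -> has_card P' E' k.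
Proof.
move=> PP' P'P EE' [f [Pf [If Sf]]].
have [g gP] : exists g, forall i, P' (g i) /\ Q (f i) (g i).
  exact: (fun_choice (Q := fun i y => P' y /\ Q (f i) y) (fun i => PP' _ (Pf i))).
exists g; split; first by move=> i; case: (gP i).
split=> [i j Eij|y P'y].
  case: (gP i) (gP j) => Pi Qi [Pj Qj].
  exact: If (proj2 (EE' _ _ _ _ (Pf i) (Pf j) Pi Pj Qi Qj) Eij).
case: (P'P y P'y) => x [Px Qxy]; case: (Sf x Px) => i Exi; exists i.
by case: (gP i) => Pi Qi; exact: (proj1 (EE' _ _ _ _ Px (Pf i) P'y Pi Qxy Qi)).
Qed.

Lemma eq_has_card (X : Type) (P P' : X -> Prop) (E E' : X -> X -> Prop) (k : nat) :
  (forall x, P x <-> P' x) -> (forall x y, E x y <-> E' x y) ->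
  has_card P E k -> has_card P' E' k.
Proof.
move=> PP' EE'; apply: (@has_card_corr _ _ _ _ _ _ (fun x y => x = y)).
- by move=> x Px; exists x; split=> //; apply/PP'.
- by move=> x Px; exists x; split=> //; apply/PP'.
- by move=> x x' y y' _ _ _ _ -> ->.
Qed.

Lemma has_card_leq (X : Type) (P : X -> Prop) (E : X -> X -> Prop) (k l : nat) :
  (forall x y, E x y -> E y x) -> (forall x y z, E x y -> E y z -> E x z) ->
  has_card P E k -> has_card P E l -> (k <= l)%N.
Proof.
move=> sE tE [f [Pf [If Sf]]] [g [Pg [Ig Sg]]].
have [h hP] : exists h : 'I_k -> 'I_l, forall i, E (f i) (g (h i)).
  exact: (fun_choice (Q := fun i j => E (f i) (g j)) (fun i => Sg _ (Pf i))).
have hI : injective h.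
  by move=> i j hij; apply: If; apply: tE (hP i) _; rewrite hij; apply: sE.
by move: (leq_card h hI); rewrite !card_ord.
Qed.

Lemma has_card_inj (X : Type) (P : X -> Prop) (E : X -> X -> Prop) (k l : nat) :
  (forall x y, E x y -> E y x) -> (forall x y z, E x y -> E y z -> E x z) ->
  has_card P E k -> has_card P E l -> k = l.
Proof.
move=> sE tE hk hl; apply/eqP; rewrite eqn_leq.
by rewrite (has_card_leq sE tE hk hl) (has_card_leq sE tE hl hk).
Qed.

Lemma has_card_finpred (X : Type) (Y : finType) (P : X -> Prop) (E : X -> X -> Prop)
    (D : {set Y}) (f : Y -> X) :
  (forall y, y \in D -> P (f y)) ->
  {in D &, forall y z, E (f y) (f z) -> y = z} ->
  (forall x, P x -> exists2 y, y \in D & E x (f y)) ->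
  has_card P E #|D|.
Proof.
move=> Pf If Sf; exists (fun i => f (enum_val i)); split.
  by move=> i; apply: Pf; apply: enum_valP.
split=> [i j Eij|x /Sf [y yD Exy]].
  by apply: enum_val_inj; apply: If => //; apply: enum_valP.
by exists (enum_rank_in yD y); rewrite enum_rankK_in.
Qed.

Lemma has_card_sub (X : Type) (P : X -> Prop) (E : X -> X -> Prop) (Q : X -> bool)
    (k : nat) (f : 'I_k -> X) :
  (forall x y, E x y -> Q x = Q y) ->
  (forall i, P (f i)) -> (forall i j, E (f i) (f j) -> i = j) ->
  (forall x, P x -> exists i, E x (f i)) ->
  has_card (fun x => P x /\ Q x) E #|[set i | Q (f i)]|.
Proof.
move=> EQ Pf If Sf; apply: (has_card_finpred (f := f)).
- by move=> i; rewrite inE.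
- by move=> i j _ _; apply: If.
- by move=> x [Px Qx]; case: (Sf x Px) => i Exi; exists i; rewrite ?inE -?(EQ _ _ Exi).
Qed.

Lemma has_card_finite (X : Type) (Y : choiceType) (P : X -> Prop) (E : X -> X -> Prop)
    (s : seq Y) (t : X -> Y) :
  (forall x, P x -> t x \in s) ->
  (forall x y, P x -> P y -> E x y <-> t x = t y) ->
  exists k, has_card P E k.
Proof.
move=> ts tE.
pose q (y : seq_sub s) : bool :=
  if excluded_middle_informative (exists x, P x /\ t x = ssval y) then true else false.
(* An inhabitant of [X] serves as default value for [f] below; if there is none, the count is 0. *)
have [[x0]|noX] := classic (exists x : X, True); last first.
  exists 0%N; exists (fun i : 'I_0 => False_rect X (notF (ltn_ord i))).
  by split; [case|split; [case|move=> x; case: noX; exists x]].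
move=> _.
have [f fP] : exists f : seq_sub s -> X, forall y,
    q y -> P (f y) /\ t (f y) = ssval y.
  apply: (fun_choice (Q := fun y x => q y -> P x /\ t x = ssval y)) => y.
  rewrite /q; case: (excluded_middle_informative _).
    by case=> x Px; exists x.
  by move=> nx; exists x0.
exists #|[set y | q y]|; apply: (has_card_finpred (f := f)).
- by move=> y; rewrite inE => /fP [].
- move=> y z; rewrite !inE => /fP [Py ty] /fP [Pz tz].
  by move/(tE _ _ Py Pz); rewrite ty tz => /val_inj.
- move=> x Px; have qx : q (SeqSub (ts x Px)).
    by rewrite /q; case: (excluded_middle_informative _) => // -[]; exists x.
  exists (SeqSub (ts x Px)); first by rewrite inE.
  by case: (fP _ qx) => Pf tf; apply/(tE _ _ Px Pf).
Qed.

(** Count the points of [X] fibre by fibre: [undup (codom t)] lists the attained values, each with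
    [p] preimages. *)
Lemma size_uniform_fibres (X : finType) (Y : eqType) (t : X -> Y) (p : nat) :
  (forall x, #|[set z | t z == t x]| = p) ->
  #|X| = (size (undup (codom t)) * p)%N.
Proof.
move=> fib; rewrite -(size_codom t).
have cnt y : y \in codom t -> count_mem y (codom t) = p.
  case/codomP=> x ->; rewrite -(fib x) cardsE cardE /codom /image_mem count_map.
  by rewrite -size_filter; congr size; rewrite !enumT.
have -> : size (codom t) = \sum_(y <- undup (codom t)) count_mem y (codom t).
  rewrite -(perm_size (perm_count_undup (codom t))) size_flatten sumnE.
  by rewrite /shape -map_comp big_map; apply: eq_bigr => y _; rewrite /= size_nseq.
rewrite (eq_big_seq (fun _ => p)) => [|y]; last by rewrite mem_undup => /cnt.
by rewrite big_const_seq count_predT iter_addn_0 mulnC.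
Qed.

(** * Homomorphisms modulo a subgroup *)

Definition subgroup (V : zmodType) (H : V -> Prop) :=
  H 0 /\ forall x y, H x -> H y -> H (x - y).

(** For [H = gen A S] this unfolds to [tor A S], so general results apply to the given notions by
    conversion. *)
Definition torsion_closure (V : zmodType) (H : V -> Prop) (x : V) :=
  exists k : nat, (0 < k)%N /\ H (x *+ k).

(* [is_hom] and [hom_eq] with [<S>] replaced by an arbitrary subgroup [H]. *)
Definition hom_mod (V G : zmodType) (H : V -> Prop) (f : V -> G) :=
  (forall x y, torsion_closure H x -> torsion_closure H y -> f (x + y) = f x + f y) /\
  (forall x, H x -> f x = 0).

Definition hom_mod_eq (V G : zmodType) (H : V -> Prop) (f g : V -> G) :=
  forall x, torsion_closure H x -> f x = g x.

Definition hom_count (V G : zmodType) (H : V -> Prop) (k : nat) :=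
  has_card (@hom_mod V G H) (hom_mod_eq H) k.

Section Subgroup.
Variables (V : zmodType) (H : V -> Prop).
Hypothesis sgH : subgroup H.

Lemma subgroup0 : H 0. Proof. by case: sgH. Qed.

Lemma subgroupB x y : H x -> H y -> H (x - y).
Proof. by case: sgH => _; apply. Qed.

Lemma subgroupN x : H x -> H (- x).
Proof. by move=> Hx; rewrite -sub0r; apply: subgroupB => //; apply: subgroup0. Qed.

Lemma subgroupD x y : H x -> H y -> H (x + y).
Proof. by move=> Hx /subgroupN Hy; rewrite -[y]opprK; apply: subgroupB. Qed.

Lemma subgroupMn x k : H x -> H (x *+ k).
Proof.
by move=> Hx; elim: k => [|k IH]; rewrite ?mulrS; [apply: subgroup0|apply: subgroupD].
Qed.

Lemma subgroupMz x c : H x -> H (x *~ c).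
Proof.
case: c => k Hx; first by rewrite -pmulrn; apply: subgroupMn.
by rewrite NegzE mulrNz -pmulrn; apply: subgroupN; apply: subgroupMn.
Qed.

Lemma subgroup_sum (I : finType) (P : pred I) (v : I -> V) :
  (forall i, P i -> H (v i)) -> H (\sum_(i | P i) v i).
Proof. by move=> Hv; apply: (big_ind H); [apply: subgroup0|apply: subgroupD|]. Qed.

Lemma subgroup_addl x y : H x -> H (x + y) <-> H y.
Proof.
move=> Hx; split=> [Hxy|]; last exact: subgroupD.
by rewrite -[y](addKr x) addrC; apply: subgroupB.
Qed.

Lemma sub_torsion_closure x : H x -> torsion_closure H x.
Proof. by exists 1%N. Qed.

Lemma subgroup_torsion_closure : subgroup (torsion_closure H).
Proof.
split; first by exists 1%N; split=> //; apply: subgroup0.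
move=> x y [j [j0 Hx]] [k [k0 Hy]]; exists (j * k)%N; split; first by rewrite muln_gt0 j0.
by rewrite mulrnBl {2}mulnC !mulrnA; apply: subgroupB; apply: subgroupMn.
Qed.

Lemma torsion_closure_Mz x (c : int) : c != 0 -> H (x *~ c) -> torsion_closure H x.
Proof.
move=> c0 Hx; exists `|c|%N; split; first by rewrite absz_gt0.
rewrite pmulrn; case: (intP c) Hx c0 => [//|k|k] Hx _.
  by rewrite absz_nat.
by rewrite abszN absz_nat -[_ *~ _]opprK -mulrNz; apply: subgroupN.
Qed.

Lemma torsion_closureK x : torsion_closure (torsion_closure H) x <-> torsion_closure H x.
Proof.
split=> [[j [j0 [k [k0 Hx]]]]|]; last by exists 1%N.
by exists (j * k)%N; split; rewrite ?muln_gt0 ?j0 // mulrnA.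
Qed.

End Subgroup.

Lemma sub_torsion_closureS (V : zmodType) (H H' : V -> Prop) :
  (forall x, H x -> H' x) -> forall x, torsion_closure H x -> torsion_closure H' x.
Proof. by move=> HH' x [k [k0 Hx]]; exists k; split; last apply: HH'. Qed.

Section HomMod.
Variables (V G : zmodType) (H : V -> Prop).
Hypothesis sgH : subgroup H.
Let sgT := subgroup_torsion_closure sgH.
Variable f : V -> G.
Hypothesis hf : hom_mod H f.

Lemma hom_mod0 : f 0 = 0.
Proof. by case: hf => _; apply; apply: subgroup0. Qed.

Lemma hom_modD x y : torsion_closure H x -> torsion_closure H y -> f (x + y) = f x + f y.
Proof. by case: hf => h _; apply: h. Qed.

Lemma hom_modN x : torsion_closure H x -> f (- x) = - f x.
Proof.
move=> tx; apply: (addIr (f x)); rewrite -hom_modD //; last exact: subgroupN.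
by rewrite !addNr hom_mod0.
Qed.

Lemma hom_modB x y : torsion_closure H x -> torsion_closure H y -> f (x - y) = f x - f y.
Proof. by move=> tx ty; rewrite hom_modD ?hom_modN //; apply: subgroupN. Qed.

Lemma hom_modMn x k : torsion_closure H x -> f (x *+ k) = f x *+ k.
Proof.
move=> tx; elim: k => [|k IH]; first by rewrite !mulr0n hom_mod0.
by rewrite !mulrS hom_modD ?IH //; apply: subgroupMn.
Qed.

End HomMod.

Section HomCount.
Variables (V G : zmodType).
Implicit Types H : V -> Prop.

Lemma hom_mod_eq_sym H (f g : V -> G) : hom_mod_eq H f g -> hom_mod_eq H g f.
Proof. by move=> e x tx; rewrite e. Qed.

Lemma hom_mod_eq_trans H (f g h : V -> G) :
  hom_mod_eq H f g -> hom_mod_eq H g h -> hom_mod_eq H f h.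
Proof. by move=> e e' x tx; rewrite e ?e'. Qed.

Lemma hom_count_inj H k l : hom_count G H k -> hom_count G H l -> k = l.
Proof.
apply: has_card_inj; [exact: hom_mod_eq_sym|exact: hom_mod_eq_trans].
Qed.

Lemma eq_hom_count H H' k : (forall x, H x <-> H' x) -> hom_count G H k -> hom_count G H' k.
Proof.
move=> HH'; have TT x : torsion_closure H x <-> torsion_closure H' x.
  by split; apply: sub_torsion_closureS => y /HH'.
apply: eq_has_card => [f|f g].
  by split=> -[fD f0]; split=> [x y /TT tx /TT|x /HH']; auto.
by split=> e x /TT; exact: e.
Qed.

(** [mult] picks some count, and counts are unique by [hom_count_inj]; exhibiting one therefore
    computes it. *)
Lemma mult_hom_count n (A : 'I_n -> V) S k : hom_count G (gen A S) k -> mult G A S = k.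
Proof.
move=> hk; apply: (hom_count_inj (H := gen A S)) (hk).
exact: (pick_natP (P := fun k => hom_count G (gen A S) k) (ex_intro _ k hk)).
Qed.

(* Homomorphisms correspond along an isomorphism [T'/H' -> T/H] of torsion subgroups
   induced by [p]. *)
Lemma hom_count_transfer (W : zmodType) (H : V -> Prop) (H' : W -> Prop) (p : W -> V) k :
  subgroup H -> subgroup H' -> (forall x y, p (x + y) = p x + p y) ->
  (forall y, torsion_closure H' y -> torsion_closure H (p y)) ->
  (forall y, torsion_closure H' y -> H (p y) <-> H' y) ->
  (forall x, torsion_closure H x -> exists y, torsion_closure H' y /\ H (x - p y)) ->
  hom_count G H k <-> hom_count G H' k.
Proof.
move=> sgH sgH' pD pT pH pS.
have sgT := subgroup_torsion_closure sgH; have sgT' := subgroup_torsion_closure sgH'.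
have pB x y : p (x - y) = p x - p y by apply: (addIr (p y)); rewrite -pD !subrK.
pose Q (f : V -> G) (g : W -> G) := forall y, torsion_closure H' y -> g y = f (p y).
have fg f : hom_mod H f -> exists g, hom_mod H' g /\ Q f g.
  move=> hf; exists (f \o p); split=> //; split=> [x y tx ty|x Hx] /=.
    by rewrite pD (hom_modD hf) //; apply: pT.
  by case: hf => _; apply; apply/pH => //; apply: sub_torsion_closure.
have gf g : hom_mod H' g -> exists f, hom_mod H f /\ Q f g.
  move=> hg.
  (* [q] chooses preimages under [p] modulo [H]; it is additive only modulo [H'], which [g] does not
     see. *)
  have [q qP] : exists q : V -> W, forall x, torsion_closure H x ->
      torsion_closure H' (q x) /\ H (x - p (q x)).
    apply: (fun_choice (Q := fun x y => torsion_closure H x ->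
      torsion_closure H' y /\ H (x - p y))) => x.
    have [/pS [y Py]|nT] := classic (torsion_closure H x); first by exists y.
    by exists 0.
  have gE x y : torsion_closure H' x -> torsion_closure H' y -> H (p x - p y) -> g x = g y.
    move=> tx ty Hxy; apply/eqP; rewrite -subr_eq0 -(hom_modB sgH' hg) //.
    apply/eqP; case: hg => _; apply; apply/pH; first exact: subgroupB.
    by rewrite pB.
  exists (g \o q); split; last first.
    move=> y ty; case: (qP _ (pT _ ty)) => tq Hq /=; apply: gE => //.
  split=> [x y tx ty|x Hx] /=.
    case: (qP _ tx) (qP _ ty) (qP _ (subgroupD sgT tx ty)) => t1 H1 [t2 H2] [t3 H3].
    rewrite -(hom_modD hg) //; apply: gE => //; first exact: subgroupD.
    rewrite pD; have := subgroupB sgH (subgroupD sgH H1 H2) H3.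
    by rewrite addrACA -opprD opprB [_ + (_ - _)]addrC addrA subrK.
  have [tq Hq] := qP _ (sub_torsion_closure Hx).
  case: hg => _; apply; apply/pH => //.
  by rewrite -[p _]opprK; apply: (subgroupN sgH); apply/(subgroup_addl sgH _ Hx).
have EE f f' g g' : Q f g -> Q f' g' -> hom_mod H f -> hom_mod H f' ->
    hom_mod_eq H f f' <-> hom_mod_eq H' g g'.
  move=> fg1 fg2 hf hf'; split=> e y ty; first by rewrite fg1 ?fg2 ?e //; apply: pT.
  have [z [tz Hyz]] := pS _ ty; rewrite -[y](subrK (p z)).
  have ? := sub_torsion_closure Hyz; have ? := pT _ tz.
  rewrite (hom_modD hf) // (hom_modD hf') // -fg1 // -fg2 // (e z) //.
  by case: hf hf' => _ -> // [_ ->].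
split.
  by apply: (@has_card_corr _ _ _ _ _ _ Q) => // f f' g g' ? ? _ _ ? ?; apply: EE.
apply: (@has_card_corr _ _ _ _ _ _ (fun g f => Q f g)) => // g g' f f' _ _ ? ? ? ?.
by symmetry; apply: EE.
Qed.

End HomCount.

(** * Inclusion-exclusion and finite generation *)

(** Expand the product over [W] of the factors 1 - [[Q t]]: taking the second term exactly on [U]
    yields the summand of [U]. *)
Lemma sum_subsets_indicator (I : finType) (W : {set I}) (Q : pred I) :
  \sum_(U : {set I} | U \subset W) (-1) ^+ #|U| * ([forall t in U, Q t] : nat)%:Z
  = ([forall t in W, ~~ Q t] : nat)%:Z.
Proof.
have prodE (Z : {set I}) (p : pred I) :
    \prod_(i in Z) ((p i : nat)%:Z) = ([forall t in Z, p t] : nat)%:Z.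
  case: (boolP [forall t in Z, p t]) => [/forall_inP pZ|/forall_inPn [i iZ /negbTE pi]].
    by rewrite big1 // => i /pZ ->.
  by rewrite (bigD1 i) //= pi mul0r.
rewrite -prodE [RHS]big_mkcond /=.
have -> : \prod_i (if i \in W then (~~ Q i : nat)%:Z else 1)
        = \prod_i (- ((i \in W) && Q i : nat)%:Z + 1).
  by apply: eq_bigr => i _; case: (i \in W); case: (Q i).
rewrite bigA_distr /= [LHS]big_mkcond; apply: eq_big => [J|J _ /=]; first by rewrite inE.
rewrite -big_mkcond /= prodrN prodE; case: (boolP (J \subset W)) => [/subsetP JW|].
  by congr (_ * (nat_of_bool _)%:Z); apply: eq_forallb_in => t /JW ->.
case/subsetPn=> t tJ tW; suff /negbTE-> : ~~ [forall t in J, (t \in W) && Q t].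
  by rewrite mulr0.
by apply/forall_inPn; exists t; rewrite // negb_and tW.
Qed.

Lemma inclusion_exclusion (I X : finType) (W : {set I}) (Q : X -> pred I) :
  \sum_(U : {set I} | U \subset W)
     (-1) ^+ #|U| * #|[set x | [forall t in U, Q x t]]|%:Z
  = #|[set x | [forall t in W, ~~ Q x t]]|%:Z.
Proof.
have cardE (p : pred X) : #|[set x | p x]|%:Z = \sum_x (p x : nat)%:Z.
  by rewrite -sum1dep_card -natz natr_sum big_mkcond; apply: eq_bigr => x _; case: (p x).
rewrite cardE; under [RHS]eq_bigr => x _ do rewrite -sum_subsets_indicator.
by rewrite exchange_big; apply: eq_bigr => U _; rewrite cardE mulr_sumr.
Qed.

(** The generator is the least positive element, or 0 if there is none; remainders of division by it
    stay in [Z]. *)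
Lemma int_subgroup_principal (Z : int -> Prop) :
  subgroup Z -> exists d, Z d /\ forall c, Z c -> exists q, c = d * q.
Proof.
move=> sgZ.
have [ex|nex] := classic (exists k : nat, (0 < k)%N /\ Z k%:Z); last first.
  exists 0; split=> [|c Zc]; first exact: subgroup0 sgZ.
  exists 0; rewrite mulr0; apply/eqP; apply: contra_notT nex => c0.
  exists `|c|%N; rewrite absz_gt0; split=> //.
  by case: (intP c) Zc c0 => // k /(subgroupN sgZ); rewrite opprK abszN.
pose p k := if excluded_middle_informative ((0 < k)%N /\ Z k%:Z) then true else false.
have pP k : reflect ((0 < k)%N /\ Z k%:Z) (p k).
  by rewrite /p; case: (excluded_middle_informative _) => h; constructor.
have exp : exists k, p k by case: ex => k /pP pk; exists k.
case: (ex_minnP exp) => d /pP [d0 Zd] dmin; exists d%:Z; split=> // c Zc.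
exists (c %/ d%:Z)%Z; rewrite {1}(divz_eq c d%:Z) mulrC.
have dz : d%:Z != 0 by rewrite -lt0n.
have r0 := modz_ge0 c dz; have rd := ltz_mod c dz.
have Zr : Z (c %% d%:Z)%Z.
  have -> : (c %% d%:Z)%Z = c - (c %/ d%:Z)%Z * d%:Z.
    by rewrite {2}(divz_eq c d%:Z) addrC addKr.
  apply: subgroupB => //; rewrite mulrC -mulrzz.
  exact: (subgroupMz sgZ).
case: (c %% d%:Z)%Z r0 rd Zr => // r _ rd Zr.
case: (posnP r) => [->|r0]; first by rewrite addr0.
have /dmin : p r by apply/pP.
by rewrite leqNgt; move: rd; rewrite ger0_norm // ltz_nat => ->.
Qed.

(** * Spans of finite lists and subgroups of finitely generated groups *)

Section Span.
Variable V : zmodType.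

(** Recursion on the list exposes the coefficient of the first generator, on which the induction of
    [subgroup_fin_gen] acts. *)
Fixpoint zspan (s : seq V) (x : V) : Prop :=
  if s is g :: s' then exists c : int, zspan s' (x - g *~ c) else x = 0.

Lemma subgroup_zspan s : subgroup (zspan s).
Proof.
elim: s => [|g s [IH0 IH]] /=; first by split=> // x y -> ->; rewrite subrr.
split; first by exists 0; rewrite mulr0z subrr.
move=> x y [c Hx] [d Hy]; exists (c - d); rewrite mulrzBr.
by have := IH _ _ Hx Hy; rewrite !opprD !opprK addrACA.
Qed.

Lemma zspan_sub (H : V -> Prop) s :
  subgroup H -> (forall g, g \in s -> H g) -> forall x, zspan s x -> H x.
Proof.
move=> sgH; elim: s => [|g s IH] Hs x /=; first by move=> ->; apply: subgroup0.
case=> c sx; rewrite -[x](subrK (g *~ c)); apply: (subgroupD sgH).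
  by apply: IH sx => h hs; apply: Hs; rewrite inE hs orbT.
by apply: subgroupMz => //; apply: Hs; rewrite inE eqxx.
Qed.

Lemma zspan_sum s x :
  zspan s x <-> exists c : 'I_(size s) -> int, x = \sum_(i < size s) s`_i *~ c i.
Proof.
split.
  elim: s x => [|g s IH] x /=; first by move=> ->; exists (fun=> 0); rewrite big_ord0.
  case=> c /IH [d dE]; exists (fun i => if unlift ord0 i is Some j then d j else c).
  rewrite big_ord_recl unlift_none /= -[x](subrK (g *~ c)) addrC dE.
  by congr (_ + _); apply: eq_bigr => i _; rewrite liftK.
case=> c ->; elim: s c => [|g s IH] c /=; first by rewrite big_ord0.
by exists (c ord0); rewrite big_ord_recl addrC addKr; apply: IH.
Qed.

Lemma fin_gen_zspan : fin_gen V -> exists s, forall x, zspan s x.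
Proof.
case=> k [g gP]; exists (codom g) => x; have [c ->] := gP x.
apply: subgroup_sum => [|i _]; first exact: subgroup_zspan.
apply: subgroupMz; first exact: subgroup_zspan.
have := codom_f g i; move: (g i) (codom g) => y s.
elim: s => // h s IH; rewrite inE => /predU1P [->|/IH ys] /=.
  by exists 1; rewrite subrr; apply: subgroup0; apply: subgroup_zspan.
by exists 0; rewrite subr0.
Qed.

(** The coefficients of [g] on elements of [H] form a subgroup of the integers, generated by some
    [d]. An element [x0] of [H] with coefficient [d], followed by generators of the part of [H]
    inside the span of the shorter list, generates [H]. *)
Lemma subgroup_fin_gen (s : seq V) (H : V -> Prop) :
  subgroup H -> (forall x, H x -> zspan s x) ->
  exists t, (forall x, x \in t -> H x) /\ (forall x, H x -> zspan t x).
Proof.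
elim: s H => [|g s IH] H sgH Hs.
  by exists [::]; split=> // x /Hs.
have sgs := subgroup_zspan s.
have [] := @int_subgroup_principal (fun c => exists x, H x /\ zspan s (x - g *~ c)).
  split; first by exists 0; rewrite mulr0z subr0; split; apply: subgroup0.
  move=> c d [x [Hx sx]] [y [Hy sy]]; exists (x - y); split; first exact: subgroupB.
  rewrite mulrzBr; have := subgroupB sgs sx sy; congr (zspan s _).
  by rewrite !opprD !opprK addrACA.
move=> d [[x0 [Hx0 sx0]] dP].
have [] := IH (fun x => H x /\ zspan s x).
- split; first by split; apply: subgroup0.
  by move=> x y [? ?] [? ?]; split; apply: subgroupB.
- by move=> x [].
move=> t [tH tP]; exists (x0 :: t); split.
  by move=> x; rewrite inE => /predU1P [->|/tH []].
move=> x Hx; case: (Hs x Hx) => c sx; have [q cE] : exists q, c = d * q.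
  by apply: dP; exists x.
exists q; apply: tP; split; first by apply: subgroupB => //; apply: subgroupMz.
have := subgroupB sgs sx (subgroupMz sgs q sx0); congr (zspan s _).
by rewrite mulrzBl -mulrzA -cE opprB addrA subrK.
Qed.

End Span.

(** The torsion closure is finitely generated, a homomorphism is determined by its values on the
    generators, and each value lies in some finite [G[k]]. *)
Lemma hom_count_exists (V G : zmodType) (H : V -> Prop) :
  fin_gen V -> torsionwise_finite G -> subgroup H -> exists k, hom_count G H k.
Proof.
move=> /fin_gen_zspan [s sP] finG sgH; have sgT := subgroup_torsion_closure sgH.
have [t [tT tP]] := subgroup_fin_gen sgT (fun x _ => sP x).
have [l lP] : exists l : seq (seq G), forall f, hom_mod H f -> map f t \in l.
  elim: t tT {tP} => [|u t IH] tT; first by exists [:: [::]] => f _; rewrite inE.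
  have [l lP] := IH (fun x xt => tT x (mem_behead (s := u :: t) xt)).
  have tu : torsion_closure H u by apply: tT; rewrite inE eqxx.
  have [k [k0 Hk]] := tu; have [r rP] := finG k k0.
  exists [seq x :: y | x <- r, y <- l] => f hf /=; apply: allpairs_f; last exact: lP.
  by apply: rP; rewrite -(hom_modMn sgH hf) //; case: hf => _; apply.
apply: (has_card_finite (s := l) (t := fun f => map f t)) => // f g hf hg; split.
  by move=> e; apply/eq_in_map => x /tT; apply: e.
move=> /eq_in_map e x tx.
suff [] : torsion_closure H x /\ f x = g x by [].
apply: (zspan_sub (H := fun x => torsion_closure H x /\ f x = g x)) (tP x tx).
  split; first by rewrite (hom_mod0 sgH hf) (hom_mod0 sgH hg); split=> //; apply: subgroup0.
  move=> y z [ty ey] [tz ez]; split; first exact: subgroupB.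
  by rewrite (hom_modB sgH hf) // (hom_modB sgH hg) // ey ez.
by move=> y yt; split; [apply: tT|apply: e].
Qed.

(** * Adjoining elements of the list *)

Section Adjoin.
Variables (V : zmodType) (I : finType) (H : V -> Prop) (v : I -> V).
Hypothesis sgH : subgroup H.

(** A general base [H] lets the same results serve the list [A] over [gen A S] and the Gale dual
    list over its own lattice. *)
Definition adjoin (U : {set I}) (x : V) : Prop :=
  exists c : I -> int, H (x - \sum_(i in U) v i *~ c i).

Lemma subgroup_adjoin U : subgroup (adjoin U).
Proof.
split; first by exists (fun=> 0); rewrite big1 // subr0; apply: subgroup0.
move=> x y [c Hx] [d Hy]; exists (fun i => c i - d i).
rewrite (eq_bigr (fun i => v i *~ c i - v i *~ d i)) => [|i _]; last exact: mulrzBr.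
rewrite big_split sumrN /= opprD opprK.
by have := subgroupB sgH Hx Hy; rewrite opprD opprK addrACA.
Qed.

Lemma adjoin_base U x : H x -> adjoin U x.
Proof. by exists (fun=> 0); rewrite big1 // subr0. Qed.

Lemma adjoin_mem (U : {set I}) i : i \in U -> adjoin U (v i).
Proof.
move=> iU; exists (fun j => (j == i)%:Z).
rewrite (bigD1 i) //= eqxx big1 => [|j /andP [_ /negbTE ->]] //.
by rewrite addr0 subrr; apply: subgroup0.
Qed.

Lemma adjoin_min (K : V -> Prop) (U : {set I}) :
  subgroup K -> (forall x, H x -> K x) -> (forall i, i \in U -> K (v i)) ->
  forall x, adjoin U x -> K x.
Proof.
move=> sgK HK vK x [c /HK Kx]; rewrite -[x](subrK (\sum_(i in U) v i *~ c i)).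
apply: (subgroupD sgK) => //; apply: (subgroup_sum sgK) => i iU.
by apply: (subgroupMz sgK); apply: vK.
Qed.

(** Hence homomorphisms modulo [H] and modulo [adjoin H v U] have the same domain and can be
    compared directly. *)
Lemma torsion_closure_adjoin (U : {set I}) :
  (forall i, i \in U -> torsion_closure H (v i)) ->
  forall x, torsion_closure (adjoin U) x <-> torsion_closure H x.
Proof.
move=> tv x; split; last by apply: sub_torsion_closureS; apply: adjoin_base.
move=> tx; apply/(torsion_closureK H); apply: sub_torsion_closureS tx.
by apply: adjoin_min => //; [apply: subgroup_torsion_closure|apply: sub_torsion_closure].
Qed.

End Adjoin.

Section Gen.
Variables (V : zmodType) (n : nat) (A : 'I_n -> V).
Implicit Types S U : {set 'I_n}.

Lemma gen_adjoin0 S x : gen A S x <-> adjoin (fun y => y = 0) A S x.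
Proof. by split=> -[c e]; exists c; [rewrite e subrr|apply: subr0_eq]. Qed.

Lemma subgroup_eq0 : subgroup (fun y : V => y = 0).
Proof. by split=> // x y -> ->; rewrite subrr. Qed.

Lemma subgroup_gen S : subgroup (gen A S).
Proof.
have [a0 aB] := subgroup_adjoin A subgroup_eq0 S.
by split=> [|x y /gen_adjoin0 hx /gen_adjoin0 hy]; apply/gen_adjoin0; auto.
Qed.

Lemma gen_mem S i : i \in S -> gen A S (A i).
Proof. by move=> iS; apply/gen_adjoin0; apply: adjoin_mem => //; apply: subgroup_eq0. Qed.

Lemma gen_min (H : V -> Prop) S :
  subgroup H -> (forall i, i \in S -> H (A i)) -> forall x, gen A S x -> H x.
Proof.
move=> sgH AH x /gen_adjoin0; apply: adjoin_min => // y ->; exact: subgroup0.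
Qed.

Lemma gen_sub S U : S \subset U -> forall x, gen A S x -> gen A U x.
Proof.
move=> /subsetP SU; apply: gen_min; first exact: subgroup_gen.
by move=> i /SU; apply: gen_mem.
Qed.

Lemma gen_setU S U x : gen A (S :|: U) x <-> adjoin (gen A S) A U x.
Proof.
have sgS := subgroup_gen S; split.
  apply: gen_min; first exact: subgroup_adjoin.
  move=> i; rewrite inE => /orP [iS|iU]; last exact: adjoin_mem.
  by apply: adjoin_base; apply: gen_mem.
apply: adjoin_min; first exact: subgroup_gen.
  by apply: gen_sub; apply: subsetUl.
by move=> i iU; apply: gen_mem; rewrite inE iU orbT.
Qed.

End Gen.

(** * Evaluation of homomorphisms at elements of a list *)

Section Values.
Variables (V G : zmodType) (I : finType) (H : V -> Prop) (v : I -> V) (U : {set I}).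
Variables (k : nat) (f : 'I_k -> V -> G).
Hypotheses (sgH : subgroup H) (tv : forall i, i \in U -> torsion_closure H (v i)).
Hypothesis f_hom : forall i, hom_mod H (f i).
Hypothesis f_inj : forall i j, hom_mod_eq H (f i) (f j) -> i = j.
Hypothesis f_surj : forall g, hom_mod H g -> exists i, hom_mod_eq H g (f i).

(** The domains coincide, so the homomorphisms modulo the larger subgroup are those modulo [H] that
    kill every [v t] with [t] in [U]; they are selected among the representatives [f]. *)
Lemma hom_count_adjoin :
  hom_count G (adjoin H v U) #|[set i | [forall t in U, f i (v t) == 0]]|.
Proof.
have tA := torsion_closure_adjoin sgH tv.
have EQ (g h : V -> G) : hom_mod_eq H g h ->
    [forall t in U, g (v t) == 0] = [forall t in U, h (v t) == 0].
  by move=> e; apply: eq_forallb_in => t tU; rewrite e //; apply: tv.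
have := has_card_sub EQ f_hom f_inj f_surj; apply: eq_has_card => g; last first.
  by move=> h; split=> e x /tA tx; apply: e.
split=> [[hg /forall_inP gU]|[gD g0]].
  split=> [x y /tA tx /tA ty|x]; first exact: (hom_modD hg).
  suff K : forall x, adjoin H v U x -> torsion_closure H x /\ g x = 0 by case/K.
  apply: adjoin_min => [|y Hy|i iU].
  - split.
      by rewrite (hom_mod0 sgH hg); split=> //; exact: subgroup0 (subgroup_torsion_closure sgH).
    move=> y z [ty gy] [tz gz]; split.
      by apply: subgroupB => //; apply: subgroup_torsion_closure.
    by rewrite (hom_modB sgH hg) // gy gz subrr.
  - by split; [apply: sub_torsion_closure|case: hg => _; apply].
  - by split; [apply: tv|apply/eqP; apply: gU].
split; first by split=> [x y /tA tx /tA ty|x Hx]; [apply: gD|apply: g0; apply: adjoin_base].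
by apply/forall_inP => t tU; apply/eqP; apply: g0; apply: adjoin_mem.
Qed.

Definition values (g : V -> G) : {ffun I -> G} :=
  [ffun t => if t \in U then g (v t) else 0].

Lemma values_eq g h : values g = values h <-> forall t, t \in U -> g (v t) = h (v t).
Proof.
split=> [e t tU|e]; first by move/ffunP/(_ t): e; rewrite !ffunE tU.
by apply/ffunP => t; rewrite !ffunE; case: ifP => // /e.
Qed.

(** Evaluation at the [v t] is additive in the homomorphism, so its nonempty fibres are cosets of
    the kernel: the count is the number of attained tuples times the size of the kernel. *)
Lemma hom_count_values :
  k = (size (undup (codom (fun i => values (f i)))) *
       #|[set i | [forall t in U, f i (v t) == 0%R]]|)%N.
Proof.
rewrite -[LHS]card_ord; apply: size_uniform_fibres => j.
(* Translation by [f j] carries the kernel onto the fibre through [f j]. *)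
pose Q (h g : V -> G) := forall x, g x = h x + f j x.
have sgT := subgroup_torsion_closure sgH.
have EQ (h : V -> G) (g g' : V -> G) : hom_mod_eq H g g' ->
    (values g == values h) = (values g' == values h).
  by move=> e; congr (_ == _); apply/values_eq => t tU; rewrite e //; apply: tv.
have EZ (g g' : V -> G) : hom_mod_eq H g g' ->
    [forall t in U, g (v t) == 0] = [forall t in U, g' (v t) == 0].
  by move=> e; apply: eq_forallb_in => t tU; rewrite e //; apply: tv.
have c1 := has_card_sub (EQ (f j)) f_hom f_inj f_surj.
have c2 := has_card_sub EZ f_hom f_inj f_surj.
apply: has_card_inj c1 _; [exact: hom_mod_eq_sym|exact: hom_mod_eq_trans|].
have hadd (h : V -> G) (s : G -> G -> G) :
    (forall a b c d, s (a + b) (c + d) = s a c + s b d) -> s 0 0 = 0 ->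
    hom_mod H h -> hom_mod H (fun x => s (h x) (f j x)).
  move=> sD s0 hh; split=> [x y tx ty|x Hx].
    by rewrite (hom_modD hh) // (hom_modD (f_hom j)).
  by case: hh (f_hom j) => _ -> // [_ ->].
apply: (has_card_corr (Q := Q)) c2 =>
  [h [hh /forall_inP h0]|g [hg /eqP/values_eq gE]|h h' g g' _ _ _ _ qg qg'].
- exists (fun x => h x + f j x); split=> //; split.
    by apply: (hadd h +%R) => //; [move=> *; apply: addrACA|apply: addr0].
  by apply/eqP/values_eq => t /h0 /eqP ->; rewrite add0r.
- exists (fun x => g x - f j x); split; last first.
    by move=> x; rewrite subrK.
  split; last by apply/forall_inP => t /gE ->; rewrite subrr.
  apply: (hadd g (fun a b => a - b)) => //; last exact: subrr.
  by move=> a b c d; rewrite opprD addrACA.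
- split=> e x tx; first by rewrite qg qg' e.
  by move: (e x tx); rewrite qg qg' => /addIr.
Qed.

End Values.

(** * Rank *)

Section Rank.
Variables (V : zmodType) (n : nat) (A : 'I_n -> V).
Implicit Types S T U : {set 'I_n}.

Definition indep_bound (H : V -> Prop) (r : nat) :=
  forall (k : nat) (w : 'I_k -> V), (forall i, H (w i)) -> zindep w -> (k <= r)%N.

(** Eliminate [A b] with a pivot [w j] whose coefficient [c j] is nonzero: the [k] cross
    combinations lie in [gen A S] and stay independent. *)
Lemma indep_bound_setU1 S b r :
  indep_bound (gen A S) r -> indep_bound (gen A (b |: S)) r.+1.
Proof.
move=> bS [//|k] w wT wI.
have [c cP] : exists c : 'I_k.+1 -> int, forall i, gen A S (w i - A b *~ c i).
  apply: (fun_choice (Q := fun i c => gen A S (w i - A b *~ c))) => i.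
  by move: (wT i); rewrite setUC => /gen_setU [c]; rewrite big_set1; exists (c b).
have [/forallP c0|/forallPn [j cj]] := boolP [forall i, c i == 0].
  apply: leqW; apply: (bS _ w) => // i.
  by have := cP i; rewrite (eqP (c0 i)) mulr0z subr0.
have sgS := subgroup_gen A S.
apply: (bS _ (fun i => w (lift j i) *~ c j - w j *~ c (lift j i))) => [i|d].
  have := subgroupB sgS (subgroupMz sgS (c j) (cP (lift j i)))
    (subgroupMz sgS (c (lift j i)) (cP j)).
  by rewrite !mulrzBl -!mulrzA [c j * _]mulrC opprB addrA subrK.
move=> d0 i.
(* The relation [d] among the combinations becomes the relation [e] among the [w i]; the coefficient
   at [j] collects the pivot terms. *)
pose e i := if unlift j i is Some i' then c j * d i' else - \sum_i c (lift j i) * d i.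
have /wI : \sum_i w i *~ e i = 0.
  rewrite (bigD1_ord j) //= {1}/e unlift_none -[RHS]d0 mulrNz mulrz_sumr addrC -sumrB.
  by apply: eq_bigr => l _; rewrite /e liftK mulrzBl -!mulrzA.
move=> /(_ (lift j i)); rewrite /e liftK => /eqP.
by rewrite mulf_eq0 (negbTE cj) => /eqP.
Qed.

Lemma indep_bound_card S : indep_bound (gen A S) #|S|.
Proof.
have [m] := ubnP #|S|; elim: m S => // m IH S.
have [->|[b bS]] := set_0Vmem S.
  move=> _ [//|k] w w0 /(_ (fun i => (i == ord0)%:Z)) wI.
  suff /wI /(_ ord0) : \sum_(i < k.+1) w i *~ (i == ord0)%:Z = 0 by rewrite eqxx.
  by apply: big1 => i _; case: (w0 i) => c ->; rewrite big_set0 mul0rz.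
rewrite (cardsD1 b) bS -{2}(setD1K bS) => /IH; exact: indep_bound_setU1.
Qed.

(** The size of [S] bounds all independent families, so a largest one exists and the choice made in
    [zrank] is a genuine rank. *)
Lemma rkP S : is_rank (gen A S) (rk A S).
Proof.
apply: (pick_natP (P := is_rank (gen A S))).
pose P r := exists w : 'I_r -> V, (forall i, gen A S (w i)) /\ zindep w.
pose p r := if excluded_middle_informative (P r) then true else false.
have pP r : reflect (P r) (p r).
  by rewrite /p; case: (excluded_middle_informative _) => h; constructor.
have exp : exists r, p r.
  by exists 0%N; apply/pP; exists (fun=> 0); split=> [[]|c _ []].
have bp r : p r -> (r <= #|S|)%N by case/pP => w [wS wI]; apply: indep_bound_card wI.
case: (ex_maxnP exp bp) => r /pP Pr rmax; exists r; split=> // k w wS wI.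
by apply: rmax; apply/pP; exists w.
Qed.

(** Adding [x] to a maximal independent family of [gen A S] exceeds the rank of [T], so there is a
    nontrivial relation, and its coefficient at [x] cannot vanish. *)
Lemma rk_eq_torsion S T : S \subset T -> rk A S = rk A T ->
  forall x, gen A T x -> tor A S x.
Proof.
move=> ST rST x Tx; have [[w [wS wI]] _] := rkP S; have [_ bT] := rkP T.
have [dep|] := classic (zindep (fun i => if unlift ord0 i is Some i' then w i' else x)).
  suff : ((rk A S).+1 <= rk A T)%N by rewrite rST ltnn.
  by apply: bT dep => i; case: (unlift ord0 i) => // j; apply: gen_sub ST _ (wS j).
move=> ndep; apply: NNPP => ntx; case: ndep => c.
rewrite big_ord_recl unlift_none.
under eq_bigr => i _ do rewrite liftK.
move=> c0; have sgS := subgroup_gen A S.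
have c00 : c ord0 = 0.
  apply/eqP; apply: contra_notT ntx => cn0; apply: (torsion_closure_Mz sgS cn0).
  have -> : x *~ c ord0 = - \sum_i w i *~ c (lift ord0 i) by apply/eqP; rewrite -addr_eq0 c0.
  by apply: (subgroupN sgS); apply: (subgroup_sum sgS) => i _; apply: (subgroupMz sgS).
move: c0; rewrite c00 mulr0z add0r => /wI wc i.
by case: (unliftP ord0 i) => [j ->|->] //; apply: wc.
Qed.

(** Clearing denominators moves an independent family of [gen A T] into [gen A S] without creating
    relations. *)
Lemma rk_leq_torsion S T : (forall x, gen A T x -> tor A S x) -> (rk A T <= rk A S)%N.
Proof.
move=> TS; have [_ bS] := rkP S; have [[w [wT wI]] _] := rkP T.
have [c cP] : exists c : 'I_(rk A T) -> nat, forall i, (0 < c i)%N /\ gen A S (w i *+ c i).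
  exact: (fun_choice (Q := fun i c => (0 < c)%N /\ gen A S (w i *+ c)) (fun i => TS _ (wT i))).
apply: (bS _ (fun i => w i *+ c i)) => [i|d d0 i]; first by case: (cP i).
have /wI/(_ i)/eqP : \sum_i w i *~ ((c i)%:Z * d i) = 0.
  by rewrite -[RHS]d0; apply: eq_bigr => j _; rewrite mulrzA -pmulrn.
rewrite mulf_eq0 => /orP [|/eqP//].
by case: (cP i); case: (c i).
Qed.

Lemma rk_setU S U : (rk A (S :|: U) <= rk A S + #|U|)%N.
Proof.
have [m] := ubnP #|U|; elim: m U => // m IH U.
have [->|[b bU]] := set_0Vmem U; first by rewrite setU0 cards0 addn0.
rewrite (cardsD1 b) bU add1n ltnS -{2}(setD1K bU) setUCA addnS => /IH le.
suff lt : (rk A (b |: (S :|: U :\ b)) <= (rk A (S :|: U :\ b)).+1)%N by apply: leq_trans lt _.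
have [[w [wT wI]] _] := rkP (b |: (S :|: U :\ b)).
have [_ bS] := rkP (S :|: U :\ b).
exact: (indep_bound_setU1 bS wT wI).
Qed.

(** If [A t] were torsion over the rest, removing [t] would keep the rank, although the rest exceeds
    [S] by too few elements to reach it. *)
Lemma rk_indep S T t : S \subset T -> rk A T = (rk A S + #|T :\: S|)%N ->
  t \in T :\: S -> ~ tor A (T :\ t) (A t).
Proof.
move=> ST rST tTS tt; have /setDP [tT tS] := tTS.
have : (rk A T <= rk A (T :\ t))%N.
  apply: rk_leq_torsion; rewrite -{1}(setD1K tT).
  apply: gen_min; first exact: (subgroup_torsion_closure (subgroup_gen A _)).
  move=> i; rewrite in_setU1 => /predU1P [->//|it].
  by apply: sub_torsion_closure; apply: gen_mem.
apply/negP; rewrite -ltnNge rST.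
have -> : T :\ t = S :|: (T :\: S) :\ t.
  apply/setP => i; rewrite !inE; case: (boolP (i \in S)) => [iS|_] /=.
    by rewrite (subsetP ST) // andbT; apply: contraNneq tS => <-.
  by [].
by apply: leq_ltn_trans (rk_setU _ _) _; rewrite ltn_add2l [X in (_ < X)%N](cardsD1 t) tTS.
Qed.

End Rank.

(** * Extension into divisible groups *)

(* Baer's argument, run on the graph of a partial homomorphism. *)
Lemma divisible_extension (V G : zmodType) (Phi : V * G -> Prop) (s : seq V) :
  divisible G -> (forall x, zspan s x) -> subgroup Phi ->
  (forall y, Phi (0, y) -> y = 0) ->
  exists f : V -> G, (forall x y, f (x + y) = f x + f y) /\
    (forall x y, Phi (x, y) -> f x = y).
Proof.
move=> divG sP sgP fP.
have [Psi [sgPsi fPsi subPsi sPsi]] : exists Psi : V * G -> Prop,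
    [/\ subgroup Psi, forall y, Psi (0, y) -> y = 0, forall p, Phi p -> Psi p &
        forall x, x \in s -> exists y, Psi (x, y)].
  have PsiM (Psi : V * G -> Prop) a b (c : int) :
    subgroup Psi -> Psi (a, b) -> Psi (a *~ c, b *~ c).
    move=> sg Pab; rewrite -[c]intz.
    apply: (subgroupMz (H := fun c => Psi (a *~ c, b *~ c))) => //.
    split; first by rewrite !mulr0z; apply: (subgroup0 sg).
    by move=> x y Px Py; rewrite !mulrzBr; apply: (subgroupB sg Px Py).
  elim: s {sP} => [|u s [Psi [sgPsi fPsi subPsi sPsi]]]; first by exists Phi.
  (* The integers [m] with [u *~ m] already in the domain are the multiples of some [k]; [z] is the
     value prescribed at [u *~ k]. *)
  have [] := @int_subgroup_principal (fun m => exists y, Psi (u *~ m, y)).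
    split; first by exists 0; rewrite mulr0z; apply: (subgroup0 sgPsi).
    by move=> c d [y Py] [z Pz]; exists (y - z); rewrite mulrzBr; apply: (subgroupB sgPsi Py Pz).
  move=> k [[z Pz] kP].
  (* The value [v] chosen at [u] must be compatible with [z]. For [k = 0] no nonzero multiple of [u]
     is constrained and 0 will do; otherwise divide by [k]. *)
  have [v vE] : exists v, v *~ k = z.
    have [k0|kn0] := eqVneq k 0.
      exists 0; rewrite mul0rz; symmetry; apply: fPsi.
      by move: Pz; rewrite k0 mulr0z.
    have k0 : (0 < `|k|)%N by rewrite absz_gt0.
    have [v vE] := divG _ k0 z; case: (intP k) vE {Pz kP kn0 k0} => [|m|m] vE.
    - by exists v.
    - by exists v; rewrite -vE.
    - by exists (- v); rewrite mulNrz mulrNz opprK -vE abszN.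
  (* Enlarge the graph by the multiples of [(u, v)]. *)
  exists (fun p => exists m : int, Psi (p.1 - u *~ m, p.2 - v *~ m)); split.
  - split; first by exists 0; rewrite /= !mulr0z !subr0; apply: (subgroup0 sgPsi).
    move=> [x y] [x' y'] /= [m Pm] [m' Pm']; exists (m - m').
    have E (W : zmodType) (a b c d : W) : a - b - (c - d) = a - c - (b - d).
      by rewrite !opprD !opprK addrACA.
    by rewrite /= !mulrzBr (E V) (E G); apply: (subgroupB sgPsi Pm Pm').
  - move=> y /= [m Pm].
    (* If [(0, y)] is in the new graph, [u *~ m] is in the old domain; so [m] is a multiple of [k]
       and the added part already lies in [Psi]. *)
    have [q mE] : exists q, m = k * q.
      apply: kP; exists (v *~ m - y).
      rewrite -opprB -[u *~ m]opprK -[- (u *~ m)]sub0r; exact: (subgroupN sgPsi Pm).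
    have := subgroupD sgPsi Pm (PsiM _ _ _ q sgPsi Pz).
    suff -> : (0 - u *~ m, y - v *~ m) + (u *~ k *~ q, z *~ q) = (0, y) by apply: fPsi.
    by congr (_, _); rewrite /= -?vE -!mulrzA -mE subrK.
  - by move=> [x y] Pxy; exists 0; rewrite /= !mulr0z !subr0; apply: subPsi.
  - move=> x; rewrite inE => /predU1P [->|/sPsi [y Py]].
      by exists v, 1; rewrite /= !subrr; apply: (subgroup0 sgPsi).
    by exists y, 0; rewrite /= !mulr0z !subr0.
have tot x : exists y, Psi (x, y).
  apply: (zspan_sub (H := fun x => exists y, Psi (x, y))) sPsi _ (sP x).
  split; first by exists 0; apply: (subgroup0 sgPsi).
  by move=> a b [y Py] [z Pz]; exists (y - z); apply: (subgroupB sgPsi Py Pz).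
have [f fE] := fun_choice tot.
have uniq x y z : Psi (x, y) -> Psi (x, z) -> y = z.
  move=> Py Pz; apply/eqP; rewrite -subr_eq0; apply/eqP; apply: fPsi.
  by have := subgroupB sgPsi Py Pz; rewrite /= -(subrr x).
exists f; split=> [x y|x y /subPsi]; last exact: uniq.
exact: uniq (fE _) (subgroupD sgPsi (fE x) (fE y)).
Qed.

(** * Torsion of the cokernel of an integer matrix *)

Definition rowspan (m k : nat) (M : 'M[int]_(m, k)) (x : 'rV[int]_k) : Prop :=
  exists u : 'rV[int]_m, x = u *m M.

Lemma subgroup_rowspan m k (M : 'M[int]_(m, k)) : subgroup (rowspan M).
Proof.
split; first by exists 0; rewrite mul0mx.
by move=> x y [u ->] [w ->]; exists (u - w); rewrite mulmxBl.
Qed.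

Lemma mulmxMn (m k l : nat) (x : 'M[int]_(m, k)) (P : 'M_(k, l)) c :
  (x *+ c) *m P = (x *m P) *+ c.
Proof. by rewrite -!scaler_nat scalemxAl. Qed.

Lemma mxMn_inj (m k : nat) c (x y : 'M[int]_(m, k)) : (0 < c)%N -> x *+ c = y *+ c -> x = y.
Proof.
move=> c0; rewrite -!scaler_nat => e; apply/matrixP => i j.
move/matrixP/(_ i j): e; rewrite !mxE => /mulfI; apply.
by rewrite pnatr_eq0 -lt0n.
Qed.

Definition diag_rect (m k : nat) (a : nat -> int) : 'M[int]_(m, k) :=
  \matrix_(i < m, j < k) (a i *+ (i == j :> nat)).

Lemma mul_diag_rect m k l a b :
  diag_rect m k a *m diag_rect k l b
  = diag_rect m l (fun i => if (i < k)%N then a i * b i else 0).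
Proof.
apply/matrixP => i j; rewrite !mxE; case: ltnP => [ik|ki].
  rewrite (bigD1 (Ordinal ik)) //= big1 => [|h hi]; rewrite !mxE /=.
    by rewrite eqxx addr0 mulr1n mulrnAr.
  suff /negbTE-> : i != h :> nat by rewrite mulr0n mul0r.
  by apply: contraNneq hi => e; apply/eqP/val_inj.
rewrite mul0rn big1 // => h _; rewrite !mxE.
suff /negbTE-> : i != h :> nat by rewrite mulr0n mul0r.
by rewrite gtn_eqF // (leq_trans (ltn_ord h)).
Qed.

Lemma tr_diag_rect m k a : (diag_rect m k a)^T = diag_rect k m a.
Proof. by apply/matrixP => i j; rewrite !mxE eq_sym; case: eqP => [->|]. Qed.

Lemma eq_diag_rect m k a b :
  (forall i, (i < m)%N -> (i < k)%N -> a i = b i) -> diag_rect m k a = diag_rect m k b.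
Proof.
by move=> ab; apply/matrixP => i j; rewrite !mxE; case: eqP => // ij; rewrite ab // ij.
Qed.

(* [P] and [Q] induce mutually inverse maps between the torsion subgroups of the
   cokernels of [M] and [M^T]; [P *m Q] is the projection onto the saturation of the
   row lattice of [M]. *)
Lemma smith_dual m k (M : 'M[int]_(m, k)) :
  exists (P : 'M[int]_(k, m)) (Q : 'M[int]_(m, k)) (Z : 'M[int]_(k, m)) (N : int),
    [/\ M *m P = P^T *m M^T, M^T *m Q = Q^T *m M,
        M *m P *m Q = M & M^T *m Q *m P = M^T] /\
    (N != 0 /\ Z *m M = N *: (P *m Q)).
Proof.
have [L uL [R uR [d _ ->]]] := int_Smith_normal_form M.
rewrite -[\matrix_(i, j) _]/(diag_rect m k (fun i => d`_i)).
(* [x] marks the nonzero invariant factors; indices beyond the length of [d] read as 0. *)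
set a := fun i => d`_i; pose x i : int := (a i != 0)%:Z.
have ax i : a i * x i = a i by rewrite /x; case: eqP => [->|_]; rewrite ?mulr0 ?mulr1.
have xx i : x i * x i = x i by rewrite /x; case: eqP.
pose N := \prod_(i < size d | d`_i != 0) d`_i.
(* [t i] is [N] divided by [a i], or 0 where [a i] is 0. *)
have [t tP] : exists t : nat -> int, forall i, t i * a i = N * x i.
  apply: (fun_choice (Q := fun i t => t * a i = N * x i)) => i; rewrite /x.
  case: eqP => [->|/eqP ai]; first by exists 0; rewrite !mulr0.
  have id : (i < size d)%N by rewrite ltnNge; apply: contra ai => h; rewrite /a nth_default.
  exists (\prod_(j < size d | (d`_j != 0) && (j != Ordinal id)) d`_j).
  by rewrite mulr1 /N [RHS](bigD1 (Ordinal id)) //= mulrC.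
have uLT : L^T \in unitmx by rewrite unitmx_tr.
have uRT : R^T \in unitmx by rewrite unitmx_tr.
(* In the coordinates given by [R] on the side of [M] and by [L^T] on the side of [M^T], both [P]
   and [Q] are the 0-1 diagonal matrix of [x]. *)
exists (invmx R *m diag_rect k m x *m L^T), (invmx L^T *m diag_rect m k x *m R).
exists (invmx R *m diag_rect k m t *m invmx L), N.
rewrite !trmx_mul !trmxK !trmx_inv !tr_diag_rect !trmxK !mulmxA.
split; last first.
  split; first by apply/prodf_neq0.
  rewrite mulmxKV // mulmxK // -!(mulmxA _ (diag_rect _ _ _) (diag_rect _ _ _)) !mul_diag_rect.
  rewrite scalemxAl scalemxAr; congr (_ *m _ *m _).
  apply/matrixP => i j; rewrite !mxE mulrnAr; congr (_ *+ _).
  by case: ifP => _; rewrite ?mulr0 // xx tP.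
split.
- rewrite !mulmxK // !mulmxKV // -!(mulmxA _ (diag_rect _ _ _) (diag_rect _ _ _)) !mul_diag_rect.
  by congr (_ *m _ *m _); apply: eq_diag_rect => i _ _; rewrite mulrC.
- rewrite !mulmxK // !mulmxKV // -!(mulmxA _ (diag_rect _ _ _) (diag_rect _ _ _)) !mul_diag_rect.
  by congr (_ *m _ *m _); apply: eq_diag_rect => i _ _; rewrite mulrC.
- rewrite !mulmxK //; do 2!rewrite -(mulmxA _ (diag_rect _ _ _) (diag_rect _ _ _)) mul_diag_rect.
  congr (_ *m _ *m _).
  by apply: eq_diag_rect => i im ik; rewrite im ik xx ax.
- rewrite !mulmxK //; do 2!rewrite -(mulmxA _ (diag_rect _ _ _) (diag_rect _ _ _)) mul_diag_rect.
  congr (_ *m _ *m _).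
  by apply: eq_diag_rect => i im ik; rewrite im ik xx ax.
Qed.

(** Integer matrices have no additive torsion, so an identity valid on the row lattice extends to
    its saturation. *)
Lemma torsion_rowspan_fix m k (M : 'M[int]_(m, k)) (P : 'M_k) x :
  M *m P = M -> torsion_closure (rowspan M) x -> x *m P = x.
Proof.
move=> MP [c [c0 [u xu]]]; apply: (mxMn_inj c0).
by rewrite -mulmxMn xu -mulmxA MP.
Qed.

(** The intertwining relations make [P] and [Q] exchange the two row lattices, and the composites
    fix the saturations. *)
Lemma hom_count_tr (G : zmodType) m k (M : 'M[int]_(m, k)) l :
  hom_count G (rowspan M) l <-> hom_count G (rowspan M^T) l.
Proof.
have [P [Q [Z [N [[MP MQ MPQ MQP] _]]]]] := smith_dual M.
have MPQ' : M *m (P *m Q) = M by rewrite mulmxA.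
have MQP' : M^T *m (Q *m P) = M^T by rewrite mulmxA.
have Prow x : rowspan M x -> rowspan M^T (x *m P).
  by case=> u ->; exists (u *m P^T); rewrite -!mulmxA MP.
have Qrow x : rowspan M^T x -> rowspan M (x *m Q).
  by case=> u ->; exists (u *m Q^T); rewrite -!mulmxA MQ.
symmetry; apply: (hom_count_transfer G (p := mulmx^~ P)).
- exact: subgroup_rowspan.
- exact: subgroup_rowspan.
- by move=> x y; rewrite mulmxDl.
- by move=> x [c [c0 Hx]]; exists c; split; rewrite // -mulmxMn; apply: Prow.
- move=> x tx; split; last exact: Prow.
  by move/Qrow; rewrite -mulmxA (torsion_rowspan_fix MPQ' tx).
- move=> x tx; exists (x *m Q); split.
    by case: tx => c [c0 Hx]; exists c; split; rewrite // -mulmxMn; apply: Qrow.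
  rewrite -mulmxA (torsion_rowspan_fix MQP' tx) subrr.
  by apply: subgroup0; apply: subgroup_rowspan.
Qed.

(** If [x] were fixed by [P *m Q], then [N] times [x] would be [x *m Z *m M], in the row lattice. So
    some column of [1 - P *m Q] pairs nontrivially with [x], and [M] kills that column. *)
Lemma rowspan_separation m k (M : 'M[int]_(m, k)) (x : 'rV[int]_k) :
  ~ torsion_closure (rowspan M) x ->
  exists u : 'cV[int]_k, M *m u = 0 /\ (x *m u) 0 0 != 0.
Proof.
have [P [Q [Z [N [[_ _ MPQ _] [N0 ZM]]]]]] := smith_dual M.
move=> ntx; have : x *m (1%:M - P *m Q) != 0.
  apply: contra_notN ntx; rewrite mulmxBr mulmx1 subr_eq0 => /eqP xPQ.
  apply: (torsion_closure_Mz (subgroup_rowspan M) N0).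
  exists (x *m Z); rewrite -mulmxA ZM -scalemxAr -xPQ.
  by rewrite -scaler_int intz.
case/rV0Pn => j xj; exists (col j (1%:M - P *m Q)); split.
  by rewrite colE mulmxA mulmxBr mulmx1 mulmxA MPQ subrr mul0mx.
by rewrite colE mulmxA -colE mxE.
Qed.

(** * Gale duality *)

Lemma rowspan_mem m k (M : 'M[int]_(m, k)) i : rowspan M (row i M).
Proof. by exists (delta_mx 0 i); rewrite rowE. Qed.

Lemma rowspan_min m k (M : 'M[int]_(m, k)) (H : 'rV[int]_k -> Prop) :
  subgroup H -> (forall i, H (row i M)) -> forall x, rowspan M x -> H x.
Proof.
move=> sgH Hr x [u ->]; rewrite mulmx_sum_row; apply: (subgroup_sum sgH) => i _.
by rewrite -[u 0 i]intz scaler_int; apply: (subgroupMz sgH).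
Qed.

Lemma subgroup_preim (V W : zmodType) (p : W -> V) (H : V -> Prop) :
  (forall x y, p (x - y) = p x - p y) -> subgroup H -> subgroup (fun x => H (p x)).
Proof.
move=> pB sgH; split; last by move=> x y Hx Hy; rewrite pB; apply: (subgroupB sgH).
by rewrite -(subrr 0) pB subrr; apply: (subgroup0 sgH).
Qed.

Lemma fin_gen_rV k : fin_gen ('rV[int]_k).
Proof.
exists k, (fun i => delta_mx 0 i) => x; exists (fun i => x 0 i).
by rewrite [LHS]row_sum_delta; apply: eq_bigr => i _; rewrite -scaler_int intz.
Qed.

(** The relations among the generators form a subgroup of a finitely generated group, hence are
    spanned by finitely many rows. *)
Lemma presentation (V : zmodType) : fin_gen V ->
  exists k m (p : 'rV[int]_k -> V) (R : 'M[int]_(m, k)),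
    [/\ forall x y, p (x - y) = p x - p y, forall y, exists x, p x = y
      & forall x, p x = 0 <-> rowspan R x].
Proof.
case=> k [g gP]; pose p (x : 'rV[int]_k) := \sum_i g i *~ x 0 i.
have pB x y : p (x - y) = p x - p y.
  by rewrite /p -sumrB; apply: eq_bigr => i _; rewrite !mxE mulrzBr.
have sgK := subgroup_preim pB (subgroup_eq0 V).
have [s sP] := fin_gen_zspan (fin_gen_rV k).
have [t [tK tP]] := subgroup_fin_gen sgK (fun x _ => sP x).
exists k, (size t), p, (\matrix_(i < size t) t`_i); split=> //.
  move=> y; case: (gP y) => c ->; exists (\row_i c i).
  by apply: eq_bigr => i _; rewrite mxE.
move=> x; split=> [/tP/zspan_sum [c ->]|].
  apply: (subgroup_sum (subgroup_rowspan _)) => i _.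
  apply: (subgroupMz (subgroup_rowspan _)).
  by rewrite -[t`_i](rowK (fun i : 'I_(size t) => t`_i)); apply: rowspan_mem.
by apply: (rowspan_min sgK) => i; rewrite rowK; apply: tK; apply: mem_nth.
Qed.

(* The [e t] form the Gale dual list; [D B] is generated by the relations between them
   and by the [e t] with [t] outside [B]. *)
Lemma gale_dual (V G : zmodType) (n : nat) (A : 'I_n -> V) : fin_gen V ->
  exists (W : zmodType) (e : 'I_n -> W) (D : {set 'I_n} -> W -> Prop),
    [/\ forall B, subgroup (D B),
        forall B l, hom_count G (gen A B) l <-> hom_count G (D B) l,
        forall (T U : {set 'I_n}) x, D (T :\: U) x <-> adjoin (D T) e U x
      & forall T t, ~ tor A (T :\ t) (A t) -> torsion_closure (D T) (e t)].
Proof.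
move=> /presentation [k [m [p [R [pB pS pK]]]]].
have [a aP] : exists a : 'I_n -> 'rV[int]_k, forall t, p (a t) = A t.
  exact: (fun_choice (Q := fun t x => p x = A t) (fun t => pS (A t))).
pose M : 'M[int]_(m + n, k) := col_mx R (\matrix_i a i).
pose keep (B : {set 'I_n}) (i : 'I_(m + n)) := if split i is inr j then j \in B else true.
have keepl B i : keep B (lshift n i) by rewrite /keep (unsplitK (inl i)).
have keepr B j : keep B (rshift m j) = (j \in B) by rewrite /keep (unsplitK (inr j)).
(* List rows outside [B] are zeroed, not deleted, so that all [B] share one ambient lattice;
   relation rows always stay. *)
pose MB B : 'M[int]_(m + n, k) := \matrix_i (if keep B i then row i M else 0).
have MBE B i j : MB B i j = if keep B i then M i j else 0.
  by rewrite !mxE; case: ifP => _; rewrite !mxE.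
have MBrow B i : row i (MB B) = if keep B i then row i M else 0 by rewrite rowK.
have rowMl i : row (lshift n i) M = row i R by rewrite rowKu.
have rowMr t : row (rshift m t) M = a t by rewrite rowKd rowK.
have p0 : p 0 = 0 by have := pB 0 0; rewrite !subrr.
have pD x y : p (x + y) = p x + p y.
  have -> : x + y = x - (0 - y) by rewrite sub0r opprK.
  by rewrite !pB p0 sub0r opprK.
(* [p] thus identifies the cokernel of [MB B] with [V] modulo [gen A B]. *)
have pMB B x : gen A B (p x) <-> rowspan (MB B) x.
  have sgM := subgroup_rowspan (MB B); split; last first.
    apply: (rowspan_min (subgroup_preim pB (subgroup_gen A B))) => i.
    rewrite MBrow; case: ifP => [|_]; last by rewrite p0; apply: (subgroup0 (subgroup_gen A B)).
    have [j ->|j ->] := split_ordP i.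
      rewrite rowMl => _; rewrite (proj2 (pK _) (rowspan_mem R j)).
      exact: (subgroup0 (subgroup_gen A B)).
    by rewrite keepr rowMr aP; apply: gen_mem.
  have RM y : rowspan R y -> rowspan (MB B) y.
    apply: (rowspan_min sgM) => i; have := rowspan_mem (MB B) (lshift n i).
    by rewrite MBrow keepl rowMl.
  move=> Bx; suff [w [pw Mw]] : exists w, p w = p x /\ rowspan (MB B) w.
    rewrite -[x](subrK w); apply: (subgroupD sgM) => //.
    by apply: RM; apply/pK; rewrite pB pw subrr.
  apply: (gen_min (H := fun y => exists w, p w = y /\ rowspan (MB B) w)) Bx.
    split; first by exists 0; split=> //; apply: (subgroup0 sgM).
    move=> y z [w [<- Mw]] [w' [<- Mw']]; exists (w - w').
    by split; [apply: pB|apply: (subgroupB sgM)].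
  move=> i iB; exists (a i); split=> //.
  by have := rowspan_mem (MB B) (rshift m i); rewrite MBrow keepr iB rowMr.
(* Leaving the dropped coordinates free amounts to adding the [e t] with [t] outside [B] to the
   column lattice of [M]. *)
pose D B (x : 'rV[int]_(m + n)) :=
  exists u : 'rV[int]_k, forall i, keep B i -> x 0 i = (u *m M^T) 0 i.
pose e t : 'rV[int]_(m + n) := delta_mx 0 (rshift m t).
have MBT B (u : 'rV[int]_k) i :
    (u *m (MB B)^T) 0 i = if keep B i then (u *m M^T) 0 i else 0.
  rewrite !mxE; case: ifP => ki; last apply: big1 => j _.
    by apply: eq_bigr => j _; rewrite [_^T _ _]mxE MBE ki [M^T _ _]mxE.
  by rewrite [_^T _ _]mxE MBE ki mulr0.
have entB (x y : 'rV[int]_(m + n)) i : (x - y) 0 i = x 0 i - y 0 i by rewrite !mxE.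
have ezE t (c : int) i : (e t *~ c) 0 i = (i == rshift m t)%:Z * c.
  have -> : e t *~ c = c *: e t by rewrite -[in RHS](intz c) scaler_int.
  by rewrite !mxE eqxx mulrC natz.
have sgD B : subgroup (D B).
  split; first by exists 0 => i _; rewrite mul0mx !mxE.
  move=> x y [u xu] [w yw]; exists (u - w) => i ki.
  by rewrite mulmxBl !entB xu // yw.
exists 'rV[int]_(m + n), e, D; split=> //.
- move=> B l.
  (* [q] erases the dropped coordinates: it sends [D B] into the row lattice of [(MB B)^T], whose
     saturation already vanishes there. *)
  pose q (x : 'rV[int]_(m + n)) : 'rV[int]_(m + n) := \row_i (if keep B i then x 0 i else 0).
  have qD x y : q (x + y) = q x + q y.
    by apply/rowP => i; rewrite !mxE; case: ifP => // _; rewrite addr0.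
  have qMn x c : q (x *+ c) = q x *+ c.
    elim: c => [|c IH]; last by rewrite !mulrS qD IH.
    by apply/rowP => i; rewrite !mxE if_same.
  have qH x : rowspan (MB B)^T (q x) <-> D B x.
    split=> -[u xu]; exists u; last first.
      by apply/rowP => i; rewrite MBT mxE; case: ifP => // /xu.
    by move=> i ki; move/rowP/(_ i): xu; rewrite MBT mxE ki.
  have qT x : torsion_closure (D B) x -> torsion_closure (rowspan (MB B)^T) (q x).
    by case=> c [c0 Hx]; exists c; split; rewrite // -qMn; apply/qH.
  have sgR := subgroup_rowspan (MB B)^T.
  rewrite -(hom_count_transfer G (p := q) l sgR (sgD B)) //; last first.
    move=> x [c [c0 [u xu]]]; exists x.
    have qx : q x = x.
      apply/rowP => i; rewrite mxE; case: ifP => // ki.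
      move/rowP/(_ i): xu; rewrite MBT ki -scaler_nat mxE => /eqP.
      by rewrite mulf_eq0 pnatr_eq0 eqn0Ngt c0 => /eqP.
    split; last by rewrite qx subrr; apply: (subgroup0 sgR).
    by exists c; split=> //; apply/qH; rewrite qMn qx; exists u.
  (* Transposition leads back to [MB B], and [p] from there to [gen A B]. *)
  rewrite -hom_count_tr.
  apply: (hom_count_transfer G (p := p)) => //.
  + exact: subgroup_gen.
  + exact: subgroup_rowspan.
  + move=> x [c [c0 Hx]]; exists c; split=> //; have /pMB := Hx.
    suff -> : p (x *+ c) = p x *+ c by [].
    by elim: (c) => [|d IH]; rewrite ?mulr0n // !mulrS pD IH.
  + move=> y ty; have [x xy] := pS y; exists x; split.
      case: ty => c [c0 Hy]; exists c; split=> //; apply/pMB.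
      suff -> : p (x *+ c) = p x *+ c by rewrite xy.
      by elim: (c) => [|d IH]; rewrite ?mulr0n // !mulrS pD IH.
    by rewrite xy subrr; apply: (subgroup0 (subgroup_gen A B)).
- move=> T U x; split; last first.
    apply: adjoin_min => // [y [u yu]|t tU].
      exists u => i; have [j ->|j ->] := split_ordP i; first by move=> _; apply: yu.
      by rewrite keepr => /setDP [jT _]; apply: yu; rewrite keepr.
    exists 0 => i; rewrite mul0mx !mxE /=.
    have [j ->|j ->] := split_ordP i; first by rewrite eq_lrshift.
    rewrite keepr eq_rshift => /setDP [_ jU].
    by case: eqP => // jt; move: jU; rewrite jt tU.
  case=> u xu; exists (fun t => (x - u *m M^T) 0 (rshift m t)); exists u => i ki.
  rewrite entB summxE.
  rewrite (eq_bigr _ (fun t _ => ezE t _ i)).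
  move: ki; have [j ->|j ->] := split_ordP i => ki.
    rewrite big1 ?subr0 ?xu // => t _; by rewrite eq_lrshift mul0r.
  have [jU|jU] := boolP (j \in U).
    rewrite (bigD1 j) //= eqxx mul1r big1 => [|t /andP [_ tj]].
      by rewrite addr0 entB opprB addrC subrK.
    by rewrite eq_rshift eq_sym (negbTE tj) mul0r.
  rewrite big1 ?subr0 => [|t tU]; first by apply: xu; rewrite keepr inE jU -keepr.
  by rewrite eq_rshift; case: eqP => [jt|]; [rewrite jt tU in jU|rewrite mul0r].
- move=> T t ntt.
  (* If [u] is killed by the rows of [MB (T :\ t)] but not by [a t], then on the coordinates kept by
     [T] the vector [u^T *m M^T] agrees with a nonzero multiple of [e t]. *)
  have [] := @rowspan_separation _ _ (MB (T :\ t)) (a t).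
    case=> c [c0 /pMB Hc]; apply: ntt; exists c; split=> //.
    suff <- : p (a t *+ c) = A t *+ c by [].
    by rewrite -aP; elim: (c) => [|d IH]; rewrite ?mulr0n // !mulrS pD IH.
  move=> u [Mu0 N0]; apply: (torsion_closure_Mz (sgD T) N0).
  exists u^T => i ki.
  rewrite ezE -trmx_mul [RHS]mxE.
  rewrite (_ : (M *m u) i 0 = (row i M *m u) 0 0); last first.
    by rewrite -row_mul [RHS]mxE.
  have [->|it] := eqVneq i (rshift m t); first by rewrite mul1r rowMr.
  have kt : keep (T :\ t) i.
    move: ki it; have [j ->|j ->] := split_ordP i => // ki.
    by rewrite keepr in_setD1 -keepr ki andbT; apply: contraNneq => ->.
  by move: (MBrow (T :\ t) i); rewrite kt mul0r => <-; rewrite -row_mul Mu0 !mxE.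

Qed.

(** * The five properties *)

Section Properties.
Variables (Gam G : zmodType) (n : nat) (A : 'I_n -> Gam).
Hypotheses (fgGam : fin_gen Gam) (finG : torsionwise_finite G).
Implicit Types S T B C U : {set 'I_n}.

Lemma mult_setU S U k (f : 'I_k -> Gam -> G) :
  (forall t, t \in U -> tor A S (A t)) ->
  (forall i, hom_mod (gen A S) (f i)) ->
  (forall i j, hom_mod_eq (gen A S) (f i) (f j) -> i = j) ->
  (forall g, hom_mod (gen A S) g -> exists i, hom_mod_eq (gen A S) g (f i)) ->
  mult G A (S :|: U) = #|[set i | [forall t in U, f i (A t) == 0]]|.
Proof.
move=> tU f1 f2 f3; apply: mult_hom_count.
apply: eq_hom_count (hom_count_adjoin (subgroup_gen A S) tU f1 f2 f3) => x.
by symmetry; apply: gen_setU.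
Qed.

Lemma mult_enum S : exists f : 'I_(mult G A S) -> Gam -> G,
  [/\ forall i, hom_mod (gen A S) (f i),
      forall i j, hom_mod_eq (gen A S) (f i) (f j) -> i = j
    & forall g, hom_mod (gen A S) g -> exists i, hom_mod_eq (gen A S) g (f i)].
Proof.
have [k hk] := hom_count_exists fgGam finG (subgroup_gen A S).
by rewrite (mult_hom_count hk); case: hk => f [f1 [f2 f3]]; exists f.
Qed.

(** By [mult_setU] the count for [a |: S] is the size of the kernel of evaluation at [A a], a factor
    of the count for [S]. *)
Lemma mult_dvd_dependent S a : rk A (a |: S) = rk A S ->
  (mult G A (a |: S) %| mult G A S)%N.
Proof.
move=> rS; have tS t : t \in [set a] -> tor A S (A t).
  move/set1P->; apply: (rk_eq_torsion (subsetUr [set a] S)); first by rewrite rS.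
  by apply: gen_mem; apply: setU11.
have [f [f1 f2 f3]] := mult_enum S.
rewrite setUC (mult_setU tS f1 f2 f3); apply/dvdnP; eexists.
exact: (hom_count_values (subgroup_gen A S) tS f1 f2 f3).
Qed.

Lemma sum_mult_dependent S T : S \subset T -> rk A S = rk A T ->
  0 <= \sum_(B : {set 'I_n} | (S \subset B) && (B \subset T))
         (-1) ^+ (#|B| - #|S|)%N * ((mult G A B)%:Z) :> int.
Proof.
move=> ST rST; have [f [f1 f2 f3]] := mult_enum S.
have tT t : t \in T -> tor A S (A t).
  by move=> tT; apply: (rk_eq_torsion ST rST); apply: gen_mem.
suff -> : \sum_(B : {set 'I_n} | (S \subset B) && (B \subset T))
         (-1) ^+ (#|B| - #|S|)%N * ((mult G A B)%:Z)
  = \sum_(U : {set 'I_n} | U \subset T :\: S)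
      (-1) ^+ #|U| * #|[set i | [forall t in U, f i (A t) == 0]]|%:Z.
  by rewrite (inclusion_exclusion (T :\: S) (fun i t => f i (A t) == 0)).
rewrite (reindex_onto (fun U => S :|: U) (fun B => B :\: S)) => [|B /andP [SB BT]]; last first.
  by apply/setP => i; rewrite !inE; case: (boolP (i \in S)) => //= /(subsetP SB).
apply: eq_big => [U|U /andP [SUT /eqP US]].
  rewrite subsetUl subUset ST /= setDUl setDv set0U subsetD.
  by rewrite (sameP eqP setDidPl).
have dSU : [disjoint S & U].
  by rewrite disjoint_sym; apply/setDidPl; rewrite -[RHS]US setDUl setDv set0U.
have UT : U \subset T :\: S.
  rewrite subsetD disjoint_sym dSU andbT.
  by case/andP: SUT => _ /(subset_trans _); apply; apply: subsetUr.
rewrite cardsU (disjoint_setI0 dSU) cards0 subn0 addKn.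
rewrite (mult_setU _ f1 f2 f3) // => t tU; apply: tT.
by have /setDP [] := subsetP UT t tU.
Qed.

(** Deleting [U] from [T] becomes adjoining the [e t] with [t] in [U], and the rank condition makes
    these torsion modulo [D T], as the counting lemmas require. *)
Lemma mult_dual : exists (W : zmodType) (e : 'I_n -> W) (D : {set 'I_n} -> W -> Prop),
  forall S T, S \subset T -> rk A T = (rk A S + #|T :\: S|)%N ->
  exists (f : 'I_(mult G A T) -> W -> G),
   [/\ subgroup (D T), forall t, t \in T :\: S -> torsion_closure (D T) (e t),
     [/\ forall i, hom_mod (D T) (f i),
         forall i j, hom_mod_eq (D T) (f i) (f j) -> i = j
       & forall g, hom_mod (D T) g -> exists i, hom_mod_eq (D T) g (f i)]
     & forall U, U \subset T :\: S ->
         mult G A (T :\: U) = #|[set i | [forall t in U, f i (e t) == 0]]|].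
Proof.
have [W [e [D [sgD DG DU Dt]]]] := gale_dual G A fgGam.
exists W, e, D => S T ST rST.
have tT t : t \in T :\: S -> torsion_closure (D T) (e t).
  by move=> tTS; apply: Dt; apply: rk_indep ST rST tTS.
have [k hk] := hom_count_exists fgGam finG (subgroup_gen A T).
rewrite (mult_hom_count hk); have /DG [f [f1 [f2 f3]]] := hk.
exists f; split=> // U UTS; apply: mult_hom_count; apply/DG.
have tU t : t \in U -> torsion_closure (D T) (e t) by move/(subsetP UTS)/tT.
apply: eq_hom_count (hom_count_adjoin (sgD T) tU f1 f2 f3) => x.
by symmetry; apply: DU.
Qed.

Lemma mult_dvd_independent S a : rk A (a |: S) = (rk A S).+1 ->
  (mult G A S %| mult G A (a |: S))%N.
Proof.
move=> rS; have aS : a \notin S.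
  by apply: contra_eqN rS => aS; rewrite (setUidPr _) ?sub1set // eqn_leq ltnn andbF.
have [W [e [D /(_ S (a |: S) (subsetUr _ _))]]] := mult_dual.
have TS : (a |: S) :\: S = [set a].
  by rewrite setDUl setDv setU0; apply/setDidPl; rewrite disjoints1.
rewrite TS cards1 addn1 => /(_ rS) [f [sgD te [f1 f2 f3] fU]].
have := fU _ (subxx _); rewrite setU1K // => ->.
apply/dvdnP; eexists; exact: (hom_count_values sgD te f1 f2 f3).
Qed.

Lemma sum_mult_independent S T : S \subset T -> rk A T = (rk A S + #|T :\: S|)%N ->
  0 <= \sum_(B : {set 'I_n} | (S \subset B) && (B \subset T))
         (-1) ^+ (#|T| - #|B|)%N * ((mult G A B)%:Z) :> int.
Proof.
move=> ST rST; have [W [e [D /(_ S T ST rST) [f [_ _ _ fU]]]]] := mult_dual.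
suff -> : \sum_(B : {set 'I_n} | (S \subset B) && (B \subset T))
         (-1) ^+ (#|T| - #|B|)%N * ((mult G A B)%:Z)
  = \sum_(U : {set 'I_n} | U \subset T :\: S)
      (-1) ^+ #|U| * #|[set i | [forall t in U, f i (e t) == 0]]|%:Z.
  by rewrite (inclusion_exclusion (T :\: S) (fun i t => f i (e t) == 0)).
(* [U] is the complement of [B] in [T], so the sign exponent [#|T| - #|B|] is [#|U|]. *)
rewrite (reindex_onto (fun U => T :\: U) (fun B => T :\: B)) => [|B /andP [SB BT]]; last first.
  by rewrite setDDr setDv set0U; apply/setIidPr.
have SD U : (S \subset T :\: U) && (T :\: U \subset T) && (T :\: (T :\: U) == U)
    = (U \subset T :\: S).
  rewrite subsetDl andbT setDDr setDv set0U subsetD ST /= subsetD disjoint_sym andbC.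
  by rewrite (sameP eqP setIidPr).
apply: eq_big => [//|U]; rewrite SD => UTS.
have /setIidPr TU : U \subset T by apply: subset_trans UTS (subsetDl _ _).
by rewrite fU // cardsD TU subKn // -TU subset_leq_card ?subsetIl.
Qed.

(** Since [B] is independent over [S], a combination that is torsion over [S] involves no element of
    [B]. This makes the partial homomorphism extended in [mult_molecule] well defined. *)
Lemma tor_gen_setU S B x : rk A (S :|: B) = (rk A S + #|B|)%N -> [disjoint S & B] ->
  tor A S x -> gen A (S :|: B) x -> gen A S x.
Proof.
move=> rB dSB tx /gen_setU [c Hc]; have sgS := subgroup_gen A S.
have SBS : (S :|: B) :\: S = B.
  by rewrite setDUl setDv set0U; apply/setDidPl; rewrite disjoint_sym.
have rSB : rk A (S :|: B) = (rk A S + #|(S :|: B) :\: S|)%N by rewrite SBS.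
suff c0 b : b \in B -> c b = 0.
  by move: Hc; rewrite big1 ?subr0 // => b /c0 ->.
move=> bB; apply/eqP; apply: contraT => cb.
have bSB : b \in (S :|: B) :\: S by rewrite SBS.
case: (rk_indep (subsetUl S B) rSB bSB).
set H := gen A ((S :|: B) :\ b).
have sgH : subgroup H := subgroup_gen A _; have sgT := subgroup_torsion_closure sgH.
have SH : forall y, gen A S y -> H y.
  apply: gen_sub; rewrite subsetD1 subsetUl.
  by rewrite (disjointFl dSB bB).
apply/(torsion_closureK H)/(torsion_closure_Mz sgT cb).
have -> : A b *~ c b = x - (x - \sum_(i in B) A i *~ c i) - \sum_(i in B | i != b) A i *~ c i.
  by rewrite (bigD1 b) //= subKr addrK.
apply: (subgroupB sgT); first apply: (subgroupB sgT).
- by apply: sub_torsion_closureS tx.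
- by apply/sub_torsion_closure/SH.
apply: (subgroup_sum sgT) => i /andP [iB ib]; apply: (subgroupMz sgT).
by apply/sub_torsion_closure/gen_mem; rewrite !inE ib iB orbT.
Qed.

Lemma mult_molecule S B C : divisible G ->
  [disjoint S & B] -> [disjoint S & C] -> [disjoint B & C] ->
  (forall R : {set 'I_n}, S \subset R -> R \subset S :|: B :|: C ->
     rk A R = (rk A S + #|R :&: B|)%N) ->
  (mult G A S * mult G A (S :|: B :|: C) = mult G A (S :|: B) * mult G A (S :|: C))%N.
Proof.
move=> divG dSB dSC dBC rR.
have rB : rk A (S :|: B) = (rk A S + #|B|)%N.
  by rewrite rR ?subsetUl // setIUl setIid (disjoint_setI0 dSB) set0U.
have rC : rk A S = rk A (S :|: C).
  rewrite [RHS]rR ?subsetUl ?setSU ?subsetUl //.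
  rewrite setIUl (disjoint_setI0 dSB) set0U setIC (disjoint_setI0 dBC).
  by rewrite cards0 addn0.
have tC t : t \in C -> tor A S (A t).
  move=> tC; apply: (rk_eq_torsion (subsetUl S C) rC).
  by apply: gen_mem; rewrite inE tC orbT.
have SSB := gen_sub (A := A) (subsetUl S B).
have tCB t : t \in C -> tor A (S :|: B) (A t).
  by move/tC; apply: sub_torsion_closureS.
have sgS := subgroup_gen A S; have sgSB := subgroup_gen A (S :|: B).
have sgT := subgroup_torsion_closure sgS.
have [f [f1 f2 f3]] := mult_enum S; have [g [g1 g2 g3]] := mult_enum (S :|: B).
have kE := hom_count_values sgS tC f1 f2 f3.
have lE := hom_count_values sgSB tCB g1 g2 g3.
have ext (h : Gam -> G) : hom_mod (gen A S) h ->
    exists h', hom_mod (gen A (S :|: B)) h' /\ forall t, t \in C -> h' (A t) = h (A t).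
  move=> hh; have [s sP] := fin_gen_zspan fgGam.
  (* The graph of the map equal to [h] on [tor A S] and to 0 on [gen A (S :|: B)], defined on their
     sum. *)
  pose Phi (p : Gam * G) := exists z,
    [/\ tor A S z, gen A (S :|: B) (p.1 - z) & p.2 = h z].
  have [||h' [h'D h'P]] := @divisible_extension _ _ Phi s divG sP.
  - split; first exists 0.
      by split; rewrite /= ?subr0 ?(hom_mod0 sgS hh) //; apply: subgroup0.
    move=> [x y] [x' y'] [z [/= tz Hz ->]] [z' [/= tz' Hz' ->]]; exists (z - z'); split => /=.
    + exact: (subgroupB sgT).
    + by have := subgroupB sgSB Hz Hz'; rewrite !opprD !opprK addrACA.
    + by rewrite (hom_modB sgS hh).
  - move=> y [z [/= tz Hz ->]]; case: hh => _; apply; apply: (tor_gen_setU rB dSB tz).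
    by rewrite -[z]opprK -sub0r -[- z]sub0r; apply: (subgroupB sgSB) => //; apply: subgroup0.
  exists h'; split; first split=> [x y _ _|x Hx]; first exact: h'D.
    apply: h'P; exists 0; split; rewrite /= ?subr0 ?(hom_mod0 sgS hh) //.
    exact: (subgroup0 sgT).
  move=> t tt; apply: h'P; exists (A t); split=> //=; first exact: tC.
  by rewrite subrr; apply: subgroup0.
(* [ext] gives one inclusion between the sets of tuples on [C]; restriction to [tor A S] gives the
   other. *)
have NE : size (undup (codom (fun i => values A C (f i))))
        = size (undup (codom (fun i => values A C (g i)))).
  apply/perm_size/uniq_perm; rewrite ?undup_uniq // => y; rewrite !mem_undup.
  apply/codomP/codomP => -[i ->].
    have [h [hh hC]] := ext _ (f1 i); have [j hj] := g3 _ hh; exists j.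
    by apply/values_eq => t tt; rewrite -(hC t tt) hj //; apply: tCB.
  have [|j hj] := f3 (g i).
    split=> [u w tu tw|x Hx]; last by case: (g1 i) => _; apply; apply: SSB.
    by apply: (hom_modD (g1 i)); apply: sub_torsion_closureS SSB _ _.
  by exists j; apply/values_eq => t tt; rewrite hj //; apply: tC.
(* Both sides equal the common number of tuples times the product of the two kernel sizes. *)
rewrite (mult_setU tC f1 f2 f3) (mult_setU tCB g1 g2 g3).
rewrite NE in kE.
by rewrite (congr1 (muln^~ _) kE) [RHS](congr1 (muln^~ _) lE) mulnAC.
Qed.

End Properties.

Unset Implicit Arguments.

Theorem mainTheorem17 (Gam G : zmodType) (n : nat) (A : 'I_n -> Gam) :
  fin_gen Gam -> torsionwise_finite G ->
  [/\ (* (1) *)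
      (forall (S : {set 'I_n}) (a : 'I_n),
          rk A (a |: S) = rk A S ->
          (mult G A (a |: S) %| mult G A S)%N),
      (* (2) *)
      (forall (S : {set 'I_n}) (a : 'I_n),
          rk A (a |: S) = (rk A S).+1 ->
          (mult G A S %| mult G A (a |: S))%N),
      (* (4) *)
      (forall S T : {set 'I_n}, S \subset T -> rk A S = rk A T ->
          0 <= \sum_(B : {set 'I_n} | (S \subset B) && (B \subset T))
                 (-1) ^+ (#|B| - #|S|)%N * ((mult G A B)%:Z)),
      (* (5) *)
      (forall S T : {set 'I_n}, S \subset T -> rk A T = (rk A S + #|T :\: S|)%N ->
          0 <= \sum_(B : {set 'I_n} | (S \subset B) && (B \subset T))
                 (-1) ^+ (#|T| - #|B|)%N * ((mult G A B)%:Z))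
    & (* (3), for divisible G *)
      (divisible G ->
       forall S B C : {set 'I_n},
         [disjoint S & B] -> [disjoint S & C] -> [disjoint B & C] ->
         (forall R : {set 'I_n}, S \subset R -> R \subset S :|: B :|: C ->
            rk A R = (rk A S + #|R :&: B|)%N) ->
         (mult G A S * mult G A (S :|: B :|: C) =
          mult G A (S :|: B) * mult G A (S :|: C))%N)].
Proof.
move=> fg tf; split.
- exact: mult_dvd_dependent.
- exact: mult_dvd_independent.
- exact: sum_mult_dependent.
- exact: sum_mult_independent.
- by move=> divG S B C; apply: mult_molecule.
Qed.
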